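(* Let $\Delta=0$ and let $t>0$. For every integer $x\le 1$ and domain wall initial condition $Y=\mathbb{N}=\{1,2,3,\dots\}$, $$\mathbb{P}_{\mathbb{N}}(X_1(t)\ge x)\big|_{\Delta=0}=\mathbb{P}(\mathcal{L}(t)\le 1-x),$$ where $\mathcal{L}(t)$ denotes the length of the longest increasing subsequence of a (uniformly distributed) random permutation of size $\mathcal{N}$, with $\mathcal{N}$ a Poisson random variable with parameter $t^2$.
   Context: Let $\mathcal{X}_N$ be the set of all $X=\{x_1<\dots<x_N\}\subset\mathbb{Z}$ and $\mathcal{H}_N=\ell^2(\mathcal{X}_N)$ with orthonormal basis $e_X(Y)=\delta_{X,Y}$. The XXZ spin-$\frac12$ Hamiltonian with anisotropy $\Delta\in\mathbb{R}$ is $H_{XXZ}=\sum_{j\in\mathbb{Z}}h_{j,j+1}$, where $h_{j,j+1}e_X=0$ if both or neither of $j,j+1$ belong to $X$, and $h_{j,j+1}e_X=-\Delta e_X+e_{X'}$ if exactly one of them belongs to $X$, with $X'$ obtained from $X$ by exchanging the occupation of $j$ and $j+1$. It is self-adjoint on $\mathcal{H}_N$. For $Y\in\mathcal{X}_N$ write $e^{-itH_{XXZ}}e_Y=\sum_X\psi_N(X;t)e_X$ and $\mathbb{P}_Y(X_1(t)\ge x)=\sum_{X\in\mathcal{X}_N,\,x_1\ge x}|\psi_N(X;t)|^2$. For the domain wall initial condition, $\mathbb{P}_{\mathbb{N}}(X_1(t)\ge x)=\lim_{N\to\infty}\mathbb{P}_{\{1,\dots,N\}}(X_1(t)\ge x)$.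 *)

(* Defs.v *)
From HB Require Import structures.
From mathcomp Require Import all_boot all_order all_fingroup all_algebra finmap.
From mathcomp Require Import complex.
From mathcomp Require Import all_classical all_reals all_analysis.

Set Implicit Arguments.
Unset Strict Implicit.
Unset Printing Implicit Defensive.

Import Order.TTheory GRing.Theory Num.Theory.
Import numFieldNormedType.Exports.

Local Open Scope classical_set_scope.
Local Open Scope ring_scope.

Definition config (N : nat) : choiceType :=
  {X : {fset int} | #|` X |%fset == N}.

Definition occ (N : nat) (X : config N) (j : int) : bool := j \in val X.

(* x_1, the smallest element of X (0 by default, only when N = 0) *)
Definition leftmost (N : nat) (X : config N) : int :=
  head 0 (sort <=%R (enum_fset (val X))).

Definition swap_site (j k : int) : int :=
  if k == j then j + 1 else if k == j + 1 then j else k.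

Lemma swap_siteK (j : int) : involutive (swap_site j).
Proof.
have jj : (j + 1 == j) = false by rewrite -subr_eq0 addrAC subrr.
move=> k; rewrite /swap_site; have [->|kj] := eqVneq k j.
  by rewrite jj eqxx.
by have [->|kj1] := eqVneq k (j + 1); rewrite ?eqxx // (negbTE kj) (negbTE kj1).
Qed.

Lemma card_exchange (N : nat) (j : int) (X : config N) :
  #|` [fset swap_site j k | k in val X] |%fset == N.
Proof.
by rewrite card_imfset /= ?(eqP (valP X)) //; exact: (can_inj (swap_siteK j)).
Qed.

(* exchange of the occupations of the sites j and j + 1 *)
Definition exchange (N : nat) (j : int) (X : config N) : config N :=
  Sub [fset swap_site j k | k in val X]%fset (card_exchange j X).

Lemma occ_exchange (N : nat) (j k : int) (X : config N) :
  occ (exchange j X) k = occ X (swap_site j k).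
Proof.
rewrite /occ /=; apply/imfsetP/idP => [[l lX ->]|kX].
  by rewrite swap_siteK.
by exists (swap_site j k) => //; rewrite swap_siteK.
Qed.

Lemma exchangeK (N : nat) (j : int) : involutive (@exchange N j).
Proof.
move=> X; apply/val_inj/fsetP => k.
change (occ (exchange j (exchange j X)) k = occ X k).
by rewrite !occ_exchange swap_siteK.
Qed.

Section Hamiltonian.
Context {R : realType}.

Definition state (N : nat) := config N -> R[i].

Definition basis (N : nat) (X : config N) : state N :=
  fun Z => (X == Z)%:R.

(* h_{j,j+1} as an operator on functions; see bond_basis for its action on
   the orthonormal basis *)
Definition bond (Delta : R) (N : nat) (j : int) (f : state N) : state N :=
  fun Z => if occ Z j (+) occ Z (j + 1)
           then - (Delta%:C)%C * f Z + f (exchange j Z) else 0.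

Lemma bond_basis (Delta : R) (N : nat) (j : int) (X : config N) :
  bond Delta j (basis X) =
  if occ X j (+) occ X (j + 1)
  then (fun Z => - (Delta%:C)%C * basis X Z + basis (exchange j X) Z)
  else (fun Z => 0).
Proof.
have Dj1 : swap_site j (j + 1) = j.
  by rewrite /swap_site eqxx -subr_eq0 addrAC subrr.
have Dj : swap_site j j = j + 1 by rewrite /swap_site eqxx.
have Eb (Z : config N) : basis X (exchange j Z) = basis (exchange j X) Z.
  by rewrite /basis -[in LHS](exchangeK j X) (can_eq (exchangeK j)).
have [ne|eq_occ] := boolP (occ X j (+) occ X (j + 1)); apply/funext => Z;
  rewrite /bond Eb; case: ifPn => // h.
- rewrite /basis; have [XZ|_] := eqVneq X Z; first by rewrite -XZ ne in h.
  have [XZ|_] := eqVneq (exchange j X) Z; last by rewrite mulr0 addr0.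
  by move: h; rewrite -XZ !occ_exchange Dj Dj1 addbC ne.
- rewrite /basis; have [XZ|_] := eqVneq X Z; first by rewrite -XZ (negbTE eq_occ) in h.
  have [XZ|_] := eqVneq (exchange j X) Z; last by rewrite mulr0 addr0.
  by move: h; rewrite -XZ !occ_exchange Dj Dj1 addbC (negbTE eq_occ).
Qed.

Lemma bond_finite_support (Delta : R) (N : nat) (f : state N) (Z : config N) :
  finite_set [set j | bond Delta j f Z != 0].
Proof.
apply: (@sub_finite_set _ _
  ([set` val Z] `|` [set j - 1 | j in [set` val Z]])).
  move=> j /=; rewrite /bond; case: ifPn => [h _|]; last by rewrite eqxx.
  have [jZ|jZ] := boolP (j \in val Z); [by left|right].
  move: h; rewrite /occ (negbTE jZ) /= => h.
  by exists (j + 1) => //; rewrite addrK.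
by rewrite finite_setU; split => //; exact: finite_image.
Qed.

(* The sum over all bonds j is a finite sum by bond_finite_support. *)
Definition H_XXZ (Delta : R) (N : nat) (f : state N) : state N :=
  fun Z => \sum_(j \in [set: int]) bond Delta j f Z.

Definition l2_normsq (N : nat) (f : state N) : \bar R :=
  \esum_(X in [set: config N]) ((ComplexField.Normc.normc (f X)) ^+ 2)%:E.

Definition exp_partial (Delta t : R) (N : nat) (f : state N) (n : nat) :
    state N :=
  fun X => \sum_(0 <= k < n)
    (- 'i%C * (t%:C)%C) ^+ k / k`!%:R * iter k (@H_XXZ Delta N) f X.

(* exp(- i t H) f, the sum in l^2 of the exponential series; H is a bounded
   operator on l^2(config N), hence the series converges for every f in l^2 *)
Definition evolution (Delta t : R) (N : nat) (f : state N) : state N :=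
  xget (fun _ => 0)
    [set g : state N |
      l2_normsq (fun X => exp_partial Delta t f n X - g X) @[n --> \oo]
        --> 0%E].

Definition prob_leftmost_ge (Delta t : R) (N : nat) (Y : config N) (x : int) :
    \bar R :=
  \esum_(X in [set X : config N | x <= leftmost X])
    ((ComplexField.Normc.normc (evolution Delta t (basis Y) X)) ^+ 2)%:E.

End Hamiltonian.

Lemma card_step (N : nat) :
  #|` [fset k in [seq Posz n | n <- iota 1 N]] |%fset == N.
Proof.
rewrite card_fseq undup_id ?size_map ?size_iota //.
by rewrite map_inj_uniq ?iota_uniq // => ? ? [].
Qed.

(* {1, ..., N} *)
Definition step_config (N : nat) : config N :=
  Sub [fset k in [seq Posz n | n <- iota 1 N]]%fset (card_step N).

Definition increasing_on (n : nat) (s : 'S_n) (A : {set 'I_n}) : bool :=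
  [forall i in A, forall j in A, (i < j)%N ==> (s i < s j)%N].

Definition lis (n : nat) (s : 'S_n) : nat :=
  (\max_(A : {set 'I_n} | increasing_on s A) #|A|)%N.

(* sigma is a random permutation whose size is a Poisson variable of parameter
   rate and which, given its size n, is uniform on 'S_n *)
Record poissonized_uniform_perm (R : realType) (d : measure_display)
    (T : measurableType d) (P : probability T R) (rate : R)
    (sigma : T -> {n : nat & 'S_n}) : Prop := {
  perm_measurable : forall (n : nat) (s : 'S_n),
    measurable [set w | sigma w = Tagged (fun n => 'S_n) s] ;
  size_poisson : forall n : nat,
    P [set w | tag (sigma w) = n] = (poisson_pmf rate n)%:E ;
  perm_uniform : forall (n : nat) (s : 'S_n),
    P [set w | sigma w = Tagged (fun n => 'S_n) s] =
    (P [set w | tag (sigma w) = n] * (n`!%:R^-1)%:E)%E }.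

(* Main.v *)
Require Import Defs.
From HB Require Import structures.
From mathcomp Require Import all_boot all_order all_fingroup all_algebra finmap.
From mathcomp Require Import complex.
From mathcomp Require Import all_classical all_reals all_analysis.
From mathcomp Require Import zify ring lra.

(** When [Delta = 0] the Hamiltonian only moves particles to empty neighbouring
sites. Near its left end, the block {1, ..., N} with a few particles moved is a
Young diagram: the i-th row is the displacement of the i-th particle, and a move
to the left, or to the right, adds, or removes, a box. The same holds at the
right end. As long as the middle of the block stays full the two ends do not see
each other, and at each end [H = U + D], where the creation [U] of a box and the
annihilation [D] satisfy [D U - U D = 1]: on any configuration, the number of
pairs (empty, occupied) minus the number of pairs (occupied, empty) among
neighbours is fixed by the two extremities of the range of bonds
([hop_commutator]).

Hence [e^{-itH} e_Y] should be the sum over [a], [b] of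
[e^{-t^2} (-it)^(a+b) / (a! b!) U_L^a U_R^b e_Y]. Its squared norm on the
configurations with [a] moves at the left and [b] at the right is
[e^{-2 t^2} t^(2a) t^(2b) / (a!^2 b!)] times the number of pairs of left words of
length [a] that lead to the same configuration ([spread_norm_right] takes care of
the right end, whose contribution sums to [e^{t^2}]). The leftmost particle is at
[1] minus the length of the first row, so that the event [x <= leftmost] only
restricts the left words. By the Robinson-Schensted correspondence the pairs of
words with first row of length at most [1 - x] are as many as the permutations
with longest increasing subsequence at most [1 - x]; the limit is therefore
[e^{-t^2}] times the sum of [t^(2a) / a!^2] times the number of those
permutations of size [a], which is the Poissonized probability.

The correspondence is obtained from the local rules of Fomin's growth diagrams.
They can be read backwards ([cell_inj]), so that a permutation is determined by
the two boundary words ([grid_inj], [perm_words]), and they transform the first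
row exactly as the length of the longest increasing subsequence in a box of the
permutation matrix evolves ([cell_first], [box_lisS]). Surjectivity
follows by counting: the commutation relation gives [a!] pairs of words in all
([spread_norm_left], [left_norm]).

With N particles the picture is exact for the first powers of [H], of exponent
less than about N / 2 ([walks_layers], [prob_part_exact]). The remainder of the
exponential series is controlled uniformly in N: a configuration reached in [n]
steps has at most [2 + 4 (n / s + 2 s)] active bonds, for every [s]
([size_active]), since displaced particles cannot all stay close to the block.
So the number of walks of length [n] is [o(epsilon^n n!)] for every positive
[epsilon] ([major_summable]), which bounds the l^1 norm of the tails
([prob_truncate]). *)

Set Implicit Arguments.
Unset Strict Implicit.
Unset Printing Implicit Defensive.

Import Order.TTheory GRing.Theory Num.Theory.
Import numFieldNormedType.Exports.

Local Open Scope classical_set_scope.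
Local Open Scope ring_scope.

(** * Local rules of growth diagrams, on occupation functions *)

(** The bond [c] is the one just before the first particle at the right of [p]. *)
Definition is_first (eta : int -> bool) (p c : int) : Prop :=
  [/\ p <= c, eta (c + 1) & forall i, p <= i <= c -> ~~ eta i].

Lemma is_first_uniq eta p c c' :
  is_first eta p c -> is_first eta p c' -> c = c'.
Proof.
move=> [pc ec h] [pc' ec' h']; case: (ltrgtP c c') => // cc'.
  by have := h' (c + 1); rewrite ec => /(_ _)/negP []//; lia.
by have := h (c' + 1); rewrite ec' => /(_ _)/negP []//; lia.
Qed.

Definition swapped (eta : int -> bool) (j : int) : int -> bool :=
  fun s => eta (swap_site j s).

Lemma swappedE eta j s : swapped eta j s =
  if s == j then eta (j + 1) else if s == j + 1 then eta j else eta s.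
Proof. by rewrite /swapped /swap_site; case: ifP => // _; case: ifP. Qed.

Lemma swappedK j : involutive (swapped^~ j).
Proof. by move=> eta; apply/funext => s; rewrite /swapped swap_siteK. Qed.

Lemma swapped_comm eta j k : (j + 1 < k) || (k + 1 < j) ->
  swapped (swapped eta j) k = swapped (swapped eta k) j.
Proof.
move=> h; apply/funext => s; rewrite !swappedE.
by repeat (case: eqP => ? //); lia.
Qed.

Definition along (k : option int) (eta : int -> bool) : int -> bool :=
  if k is Some j then swapped eta j else eta.

Section Growth.
Variables lo hi : int.

(** The bonds from [hi] on are excluded: the particles beyond [hi] belong to the
other end of the block. *)
Definition allowed (k : option int) (eta : int -> bool) : bool :=
  if k is Some j then [&& j < hi, ~~ eta j & eta (j + 1)] else true.

(** The search is bounded by [hi]; its value is meaningful when [p] is empty and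
[hi] is occupied ([first_bondP]). *)
Definition first_bond (eta : int -> bool) (p : int) : int :=
  p + (find (fun i => eta (p + i%:Z + 1)) (iota 0 (absz (hi - p)%R)))%:Z.

Lemma first_bondP eta p : ~~ eta p -> eta hi -> p < hi ->
  is_first eta p (first_bond eta p) /\ first_bond eta p < hi.
Proof.
move=> ep ehi phi; rewrite /first_bond.
set P := fun i : nat => _; set r := iota 0 _.
have hP : has P r.
  apply/hasP; exists (absz (hi - p - 1)%R); first by rewrite mem_iota; lia.
  by rewrite /P; have -> : p + (absz (hi - p - 1)%R)%:Z + 1 = hi :> int by lia.
have szr : size r = (absz (hi - p)%R) by rewrite size_iota.
have lt : (find P r < absz (hi - p)%R)%N by rewrite -szr -has_find.
split; last by lia.
split; first by lia.
  by have := nth_find 0%N hP; rewrite nth_iota ?add0n.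
move=> i /andP[pi ic]; have [->//|nip] := eqVneq i p.
have lti : (absz (i - p - 1)%R < find P r)%N by lia.
have := before_find 0%N lti; rewrite nth_iota ?add0n; last by lia.
by rewrite /P (_ : p + _ + 1 = i) => [->//|]; lia.
Qed.

Lemma first_bond_eq eta p c : is_first eta p c -> c < hi -> eta hi ->
  first_bond eta p = c.
Proof.
move=> fc chi ehi; have [h1 h2 h3] := fc.
have [] := @first_bondP eta p => //; [by apply: h3; lia|by lia|].
by move=> fc' _; exact: is_first_uniq fc' fc.
Qed.

(** Fomin's local rule. The vertices of a cell carry diagrams: [rho] in one corner,
its neighbours along the edges [k] and [v], and the opposite corner, reached by
the two edges returned. An edge is [None], or [Some j] when the particle at [j + 1]
moves to [j], that is when a box of content [- j] is added. If the cell holds an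
entry of the permutation, a box is added to the first row; if the two edges add the
same box, the next one goes to the following row, whose particle is the next one at
the right; otherwise the two moves commute. *)
Definition cell (rho : int -> bool) (k v : option int) (b : bool) :
    option int * option int :=
  if b then (Some (first_bond rho lo), Some (first_bond rho lo))
  else if k == v then
    if k is Some j then
      let c := first_bond (swapped rho j) (j + 1) in (Some c, Some c)
    else (None, None)
  else (k, v).

(** What the local rules need: some room at the left and a full site [hi]. *)
Definition tame (eta : int -> bool) : Prop :=
  (forall s, s <= lo -> ~~ eta s) /\ eta hi.

Hypothesis lohi : lo < hi.

Lemma first_bond_tame eta : tame eta ->
  is_first eta lo (first_bond eta lo) /\ first_bond eta lo < hi.
Proof. by move=> [h1 h2]; apply: first_bondP => //; exact: h1. Qed.

Lemma allowed_first eta p c : is_first eta p c -> c < hi -> allowed (Some c) eta.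
Proof. by move=> [h1 h2 h3] chi /=; rewrite chi h2 andbT /=; apply: h3; lia. Qed.

Lemma first_bond_after rho j : tame (swapped rho j) -> allowed (Some j) rho ->
  is_first (swapped rho j) (j + 1) (first_bond (swapped rho j) (j + 1)) /\
  first_bond (swapped rho j) (j + 1) < hi.
Proof.
move=> [_ thi] /and3P[jhi rj rj1].
have e : ~~ swapped rho j (j + 1).
  by rewrite swappedE ifF ?eqxx //; apply/eqP; lia.
apply: first_bondP => //.
by case: (ltrgtP (j + 1) hi) => // [|E]; [lia|move: thi; rewrite -E (negbTE e)].
Qed.

(** Two different moves allowed from the same configuration are at distance at
least two, so that they commute. *)
Lemma cellP rho k v (b : bool) : tame rho -> tame (along k rho) ->
  allowed k rho -> allowed v rho -> (b -> k = None /\ v = None) ->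
  let: (k', v') := cell rho k v b in
  [/\ allowed k' (along v rho), allowed v' (along k rho),
      along k' (along v rho) = along v' (along k rho),
      isSome k' = isSome k || b & isSome v' = isSome v || b].
Proof.
move=> trho tk ak av bkv; rewrite /cell; case: b bkv => [[]//-> ->|_].
  have [f1 f2] := first_bond_tame trho.
  by split => //; apply: allowed_first f1 f2.
have [kv|kv] := eqVneq k v.
  case: v kv tk ak av => [j ->|->] //= tk ak av.
  have [f1 f2] := first_bond_after tk ak.
  by split => //; apply: allowed_first f1 f2.
rewrite !orbF; case: k v kv tk ak av => [j|] [j'|] //= jj' tk;
  [|by move=> ? ?; split..].
move=> /and3P[a1 a2 a3] /and3P[b1 b2 b3].
have nj : j != j' by apply: contra jj' => /eqP ->.
have j1 : j + 1 != j' by apply: contraNN b2 => /eqP <-.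
have j2 : j' + 1 != j by apply: contraNN a2 => /eqP <-.
have far : (j + 1 < j') || (j' + 1 < j) by lia.
split => //; last by rewrite swapped_comm // orbC.
  by rewrite a1 !swappedE; do ! (case: eqP => ?; try lia); rewrite a2.
by rewrite b1 !swappedE; do ! (case: eqP => ?; try lia); rewrite b2.
Qed.

Lemma along_inj k : injective (along k).
Proof. by case: k => [j|] // e1 e2 /= /(can_inj (swappedK j)). Qed.

(** The outputs of a cell determine its inputs. When the two outputs are the same
bond [c], the particle that jumps over [c] is either the first one, which betrays an
entry in the cell, or the successor of the particle that moved over the common input
bond; distinct particles have distinct successors. *)
Lemma cell_inj rho k v (b : bool) rho0 k0 v0 (b0 : bool) :
  tame rho -> tame (along k rho) ->
  allowed k rho -> allowed v rho -> (b -> k = None /\ v = None) ->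
  tame rho0 -> tame (along k0 rho0) ->
  allowed k0 rho0 -> allowed v0 rho0 -> (b0 -> k0 = None /\ v0 = None) ->
  cell rho k v b = cell rho0 k0 v0 b0 ->
  along (cell rho k v b).2 (along k rho) =
  along (cell rho0 k0 v0 b0).2 (along k0 rho0) ->
  [/\ k = k0, v = v0, b = b0 & rho = rho0].
Proof.
move=> t1 t1' ak av bkv t2 t2' ak0 av0 bkv0 ec; rewrite ec => /along_inj el.
suff [ek ev eb] : [/\ k = k0, v = v0 & b = b0].
  by split => //; move: el; rewrite ek => /along_inj.
have split_case rh ka va (bb : bool) : tame rh -> tame (along ka rh) ->
    allowed ka rh -> (bb -> ka = None /\ va = None) ->
    let nu := along ka rh in
    [\/ cell rh ka va bb = (ka, va) /\ ~~ bb /\ (ka = va -> ka = None),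
       exists c, [/\ cell rh ka va bb = (Some c, Some c), bb, is_first nu lo c,
                  ka = None & va = None] |
       exists c j, [/\ cell rh ka va bb = (Some c, Some c), ~~ bb,
                 is_first nu (j + 1) c, nu j /\ lo < j & ka = Some j /\ va = Some j]].
  move=> tr tka aka bb0 nu; rewrite /cell; case: bb bb0 => [[]// ek0 ev0|_].
    constructor 2; exists (first_bond rh lo); split => //.
    by rewrite /nu ek0; have [] := first_bond_tame tr.
  case: eqVneq => [E|E]; last by constructor 1; split => //; split => // F;
    rewrite F eqxx in E.
  case: va E => [j|] E; last by constructor 1; rewrite E.
  rewrite E; constructor 3; exists (first_bond (swapped rh j) (j + 1)), j.
  rewrite /nu E in tka aka *; have [f1 f2] := first_bond_after tka aka.
  have nuj : swapped rh j j by rewrite swappedE eqxx; case/and3P: aka.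
  split => //; split => //; case: (ltP lo j) => // jlo.
  by have [+ _] := tka => /(_ _ jlo); rewrite /= nuj.
have key (eta : int -> bool) p j c : eta j -> p < j + 1 -> is_first eta p c ->
  is_first eta (j + 1) c -> False.
  move=> ej pj [h1 h2 h3] [h4 h5 h6].
  by have := h3 j; rewrite ej => /(_ _)/negP []//; lia.
have := split_case _ _ v _ t1 t1' ak bkv.
have := split_case _ _ v0 _ t2 t2' ak0 bkv0.
rewrite /= -{}el; set nu := along k rho => {t1 t1' t2 t2' ak av ak0 av0}.
case=> [[E0 [nb0 d0]]|[c0 [E0 bb0 f0 ek0 ev0]]|[c0 [j0 [E0 nb0 f0 [nj0 lj0] [ek0 ev0]]]]];
  case=> [[E [nb d]]|[c [E bb f ek ev]]|[c [j [E nb f [nj lj] [ek ev]]]]];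
  move: ec; rewrite E E0 => -[].
- by move=> -> ->; split => //; rewrite (negbTE nb) (negbTE nb0).
- by move=> e1 e2; move: d0; rewrite -e1 -e2 => /(_ erefl).
- by move=> e1 e2; move: d0; rewrite -e1 -e2 => /(_ erefl).
- by move=> e1 e2; move: d; rewrite e1 e2 => /(_ erefl).
- by rewrite ek ev ek0 ev0 bb bb0.
- move=> e _; exfalso; rewrite e in f; apply: (key nu lo j c0) => //; lia.
- by move=> e1 e2; move: d; rewrite e1 e2 => /(_ erefl).
- move=> e _; exfalso; rewrite e in f; apply: (key nu lo j0 c0) => //; lia.
- move=> e _; rewrite e in f; rewrite ek ev ek0 ev0 (negbTE nb) (negbTE nb0).
  suff -> : j = j0 by [].
  case: (ltrgtP j j0) => // jj; exfalso.
    by apply: (key nu (j + 1) j0 c0) => //; lia.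
  by apply: (key nu (j0 + 1) j c0) => //; lia.
Qed.

Lemma first_along eta c f : is_first eta lo f -> allowed (Some c) eta -> (c = f ->
  lo < f) ->
  is_first (swapped eta c) lo (if c == f then f - 1 else f).
Proof.
move=> [h1 h2 h3] /and3P[_ c1 c2] lf; case: eqP => [cf|cf]; split => //; try lia.
- by rewrite subrK swappedE cf eqxx.
- move=> i ifi; rewrite swappedE; do ! (case: eqP => ?; try lia).
  by apply: h3; lia.
- by rewrite swappedE; do ! (case: eqP => ?; try lia).
move=> i ifi; rewrite swappedE; do ! (case: eqP => ?; try lia) => //.
- by have := h3 (c + 1); rewrite c2 => /(_ _)/negP[]//; lia.
- exact: h3.
Qed.

(** Minus the bond before the leftmost particle is the length of the first row.
The rule for it is that of a longest increasing subsequence: an entry extends the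
subsequences of the smaller box, otherwise one keeps the best of the two neighbours. *)
Lemma cell_first rho k v (b : bool) (l := fun eta => - first_bond eta lo) :
  tame rho -> tame (along k rho) -> tame (along v rho) ->
  tame (along (cell rho k v b).2 (along k rho)) ->
  allowed k rho -> allowed v rho -> (b -> k = None /\ v = None) ->
  l (along (cell rho k v b).2 (along k rho)) =
  if b then l rho + 1 else Num.max (l (along k rho)) (l (along v rho)).
Proof.
have along_first c eta : tame eta -> allowed (Some c) eta ->
    tame (swapped eta c) ->
    l (swapped eta c) = if c == first_bond eta lo then l eta + 1 else l eta.
  move=> te ac ts; have [f1 f2] := first_bond_tame te.
  have [g1 g2] := first_bond_tame ts.
  have lf : c = first_bond eta lo -> lo < first_bond eta lo.
    have [h1 h2 h3] := f1; case: (ltrgtP lo (first_bond eta lo)) => // [|E ce];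
      first by lia.
    by have := ts.1 lo; rewrite lexx swappedE ce -E eqxx [in eta _]E h2 => /(_ erefl).
  rewrite /l (first_bond_eq (first_along f1 ac lf)); first by case: ifP; lia.
    by case: ifP; lia.
  exact: ts.2.
rewrite /cell => tr tk tv.
case: b => [tl ak av []// ek ev|].
  rewrite {}ek in tk tl *; rewrite along_first ?eqxx //.
  by have [f1 f2] := first_bond_tame tr; exact: allowed_first f1 f2.
have [->|kv] := eqVneq k v.
  case: v tv => [j|] tv tl ak av _; last by rewrite maxxx.
  rewrite /= in tv tl *; have [f1 f2] := first_bond_after tv av.
  rewrite maxxx along_first //; last exact: allowed_first f1 f2.
  case: eqP => // E; exfalso; move: f1; rewrite E.
  have [[h1 h2 h3] _] := first_bond_tame tv; case=> k1 _ _.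
  have lj : lo < j.
    case: (ltP lo j) => // jlo; have [+ _] := tv => /(_ _ jlo).
    by rewrite swappedE eqxx; case/and3P: av => _ _ ->.
  have := h3 j; rewrite swappedE eqxx; case/and3P: av => _ _ -> /(_ _)/negP[] //.
  lia.
case: k v kv tk tv => [j|] [j'|] //= jj' tk tv tl ak av _; last 2 first.
- by rewrite along_first //; case: ifP => _; rewrite (elimT max_idPl) //; lia.
- by rewrite along_first //; case: ifP => _; rewrite (elimT max_idPr) //; lia.
have nj : j != j' by apply: contra jj' => /eqP ->.
have aj' : allowed (Some j') (swapped rho j).
  have := @cellP rho (Some j) (Some j') false tr tk ak av; rewrite /cell (negbTE jj').
  by case.
have lr := along_first _ _ tr.
rewrite along_first // (lr j) // (lr j') //.
have [f1 f2] := first_bond_tame tr.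
have [h1 h2 h3] := f1.
have lf : j = first_bond rho lo -> lo < first_bond rho lo.
  move=> ej; case: (ltrgtP lo (first_bond rho lo)) => // [|E]; first by lia.
  by have := tk.1 lo; rewrite lexx swappedE ej -E eqxx [in rho _]E h2 => /(_ erefl).
rewrite (first_bond_eq (first_along f1 ak lf)); last exact: tk.2; last by case: ifP; lia.
rewrite (eq_sym j (first_bond rho lo)) (eq_sym j' (first_bond rho lo)).
case: (eqVneq (first_bond rho lo) j) => [ej|nej].
  rewrite ej (negbTE nj) -ej ifF; first by rewrite (elimT max_idPl) //; lia.
  apply/eqP => E; case/and3P: av => _ _; rewrite E subrK => rf.
  by have := h3 (first_bond rho lo); rewrite h1 lexx rf => /(_ erefl).
by case: eqP => [->|] //; [rewrite eqxx|case: eqP]; lia.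
Qed.

Section Grid.
Variables (eta0 : int -> bool) (b : nat -> nat -> bool).

(** The growth diagram is computed row after row: [hor i] lists the edges of the row
of height [i], [shape i j] is the diagram at the corner of the box [i] x [j]. *)
Fixpoint shapes (k : nat -> option int) (j : nat) : int -> bool :=
  if j is j'.+1 then along (k j') (shapes k j') else eta0.

Fixpoint verts (k : nat -> option int) (bi : nat -> bool) (j : nat) :=
  if j is j'.+1 then (cell (shapes k j') (k j') (verts k bi j') (bi j')).2
  else None.

Fixpoint hor (i : nat) : nat -> option int :=
  if i is i'.+1 then fun j =>
    (cell (shapes (hor i') j) (hor i' j) (verts (hor i') (b i') j) (b i' j)).1
  else fun=> None.

Definition vert (i j : nat) : option int := verts (hor i) (b i) j.
Definition shape (i j : nat) : int -> bool := shapes (hor i) j.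

(** What remains true after [d] moves from the full half-line: only sites between
[- d] and [d] can have changed. *)
Definition confined (d : int) (eta : int -> bool) : Prop :=
  (forall s, s <= - d -> ~~ eta s) /\ (forall s, d < s <= hi -> eta s).

Lemma confined_along d k eta : confined d eta -> allowed k eta ->
  confined (d + 1) (along k eta).
Proof.
move=> [h1 h2]; case: k => [j|] /=; last first.
  by move=> _; split => s hs; [apply: h1|apply: h2]; lia.
move=> /and3P[jhi ej ej1].
have jd : j <= d by case: (leP j d) => // dj; move: ej; rewrite h2 //; lia.
have jd' : - d <= j.
  by case: (leP (- d) j) => // dj; move: ej1; rewrite (negbTE (h1 _ _)) //; lia.
split => s hs; rewrite swappedE; do ! (case: eqP => ?; try lia) => //.
  by apply: h1; lia.
by apply: h2; lia.
Qed.

Variable n : nat.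
Hypotheses (nlo : lo = - n%:Z) (nhi : n%:Z < hi).
Hypothesis eta0P : confined 0 eta0.
Hypothesis brow : forall i j j', b i j -> b i j' -> j = j'.
Hypothesis bcol : forall i i' j, b i j -> b i' j -> i = i'.

Lemma confined_tame (d : nat) eta : (d <= n)%N -> confined d%:Z eta -> tame eta.
Proof. by move=> dn [h1 h2]; split => [s hs|]; [apply: h1|apply: h2]; lia. Qed.

(** An edge is trivial until the corresponding line meets its entry of the
permutation matrix; in particular the cell of an entry has two trivial inputs, as
[cell] requires. *)
Definition row_inv i := forall j, (j <= n)%N ->
  confined i%:Z (shape i j) /\
  ((j < n)%N -> allowed (hor i j) (shape i j) /\
     isSome (hor i j) = has (b^~ j) (iota 0 i)).

Lemma vert_inv i : (i < n)%N -> row_inv i -> forall j, (j <= n)%N ->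
  [/\ allowed (vert i j) (shape i j),
      along (vert i j) (shape i j) = shape i.+1 j &
      isSome (vert i j) = has (b i) (iota 0 j)].
Proof.
move=> iN inv; elim=> [|j IH] jn; first by split.
have [av sv hv] := IH (ltnW jn).
have [wj /(_ jn)[ah hh]] := inv _ (ltnW jn).
have [wj1 _] := inv _ jn.
have tr := confined_tame (ltnW iN) wj; have tk := confined_tame (ltnW iN) wj1.
have bkv : b i j -> hor i j = None /\ vert i j = None.
  move=> bij; split; [move: hh|move: hv]; case: (X in isSome X) => // x /esym /hasP[z].
    by rewrite mem_iota => zi bz; have := bcol bij bz; lia.
  by rewrite mem_iota => zi bz; have := brow bij bz; lia.
have := cellP tr tk ah av bkv.
rewrite (surjective_pairing (cell _ _ _ _)) => -[c1 c2 c3 c4 c5].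
split => //.
  rewrite (_ : shape i.+1 j.+1 = along (hor i.+1 j) (shape i.+1 j)) // -sv.
  exact/esym/c3.
rewrite -[in iota _ _]addn1 iotaD has_cat /= orbF -hv; exact: c5.
Qed.

Lemma row_invP i : (i <= n)%N -> row_inv i.
Proof.
elim: i => [|i IH] iN.
  move=> j jn; split=> //.
  have -> : shape 0 j = eta0 by elim: j {jn} => // j.
  exact: eta0P.
have inv := IH (ltnW iN); have V := vert_inv iN inv.
move=> j jn; have [av sv hv] := V j jn; have [wj hj] := inv j jn.
split; first by rewrite -sv -addn1 PoszD; apply: confined_along.
move=> jn'; have [ah hh] := hj jn'; have [wj1 _] := inv _ jn'.
have tr := confined_tame (ltnW iN) wj; have tk := confined_tame (ltnW iN) wj1.
have bkv : b i j -> hor i j = None /\ vert i j = None.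
  move=> bij; split; [move: hh|move: hv]; case: (X in isSome X) => // x /esym /hasP[z].
    by rewrite mem_iota => zi bz; have := bcol bij bz; lia.
  by rewrite mem_iota => zi bz; have := brow bij bz; lia.
have := cellP tr tk ah av bkv.
rewrite (surjective_pairing (cell _ _ _ _)) => -[c1 c2 c3 c4 c5].
rewrite -sv; split => //.
rewrite -[in iota _ _]addn1 iotaD has_cat /= orbF -hh; exact: c4.
Qed.

Lemma shapeS i j : (i < n)%N -> (j <= n)%N ->
  shape i.+1 j = along (vert i j) (shape i j).
Proof. by move=> iN jn; have [] := vert_inv iN (row_invP (ltnW iN)) jn. Qed.

Lemma vert_allowed i j : (i < n)%N -> (j <= n)%N -> allowed (vert i j) (shape i j).
Proof. by move=> iN jn; have [] := vert_inv iN (row_invP (ltnW iN)) jn. Qed.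

Lemma vert_some i j : (i < n)%N -> (j <= n)%N ->
  isSome (vert i j) = has (b i) (iota 0 j).
Proof. by move=> iN jn; have [] := vert_inv iN (row_invP (ltnW iN)) jn. Qed.

Lemma hor_allowed i j : (i <= n)%N -> (j < n)%N -> allowed (hor i j) (shape i j).
Proof. by move=> iN jn; have [_ /(_ jn)[]] := row_invP iN (ltnW jn). Qed.

Lemma hor_some i j : (i <= n)%N -> (j < n)%N ->
  isSome (hor i j) = has (b^~ j) (iota 0 i).
Proof. by move=> iN jn; have [_ /(_ jn)[]] := row_invP iN (ltnW jn). Qed.

Lemma shape_tame i j : (i <= n)%N -> (j <= n)%N -> tame (shape i j).
Proof. by move=> iN jn; have [w _] := row_invP iN jn; apply: confined_tame w. Qed.

Lemma cell_empty i j : (i < n)%N -> (j < n)%N ->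
  b i j -> hor i j = None /\ vert i j = None.
Proof.
move=> iN jn bij; have := hor_some (ltnW iN) jn; have := vert_some iN (ltnW jn).
move=> hv hh; split; [move: hh|move: hv]; case: (X in isSome X) => // x /esym /hasP[z].
  by rewrite mem_iota => zi bz; have := bcol bij bz; lia.
by rewrite mem_iota => zi bz; have := brow bij bz; lia.
Qed.

(** The first rows of the diagrams obey the recursion and the boundary values that
determine [lr]. *)
Lemma shape_first (lr : nat -> nat -> nat) :
  (forall j, lr 0%N j = 0%N) -> (forall i, lr i 0%N = 0%N) ->
  (forall i j, lr i.+1 j.+1 =
     if b i j then (lr i j).+1 else maxn (lr i j.+1) (lr i.+1 j)) ->
  forall i j, (i <= n)%N -> (j <= n)%N ->
    (lr i j)%:Z = - first_bond (shape i j) lo.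
Proof.
move=> lr0 lr0' lrS.
have base eta : confined 0 eta -> - first_bond eta lo = 0.
  move=> w; rewrite (_ : first_bond eta lo = 0) ?oppr0 //.
  case: (posnP n) => [n0|n0].
    by apply: first_bond_eq; [split|..]; rewrite ?nlo ?n0; try lia; try (apply: w.2;
      lia); move=> i hi'; apply: w.1; lia.
  apply: first_bond_eq; [split|..]; try lia; try (apply: w.2; lia).
  by move=> i hi'; apply: w.1; lia.
elim=> [|i IHi] j iN.
  move=> jn; rewrite lr0 base //; have -> : shape 0 j = eta0 by elim: j {jn} => // j.
  exact: eta0P.
elim: j => [|j IHj] jn; first by rewrite lr0' base //; exact: eta0P.
have tr := shape_tame (ltnW iN) (ltnW jn).
have tk := shape_tame (ltnW iN) jn.
have tv := shape_tame iN (ltnW jn).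
have tl := shape_tame iN jn.
have ah := hor_allowed (ltnW iN) jn; have av := vert_allowed iN (ltnW jn).
have := @cell_first (shape i j) (hor i j) (vert i j) (b i j).
have E1 : along (hor i j) (shape i j) = shape i j.+1 by [].
have E2 := shapeS iN (ltnW jn).
have E3 := shapeS iN jn.
rewrite E1 -E2 -/(vert i j.+1) -E3.
move=> /(_ tr tk tv tl ah av (cell_empty iN jn)) ->.
have e1 := IHi j (ltnW iN) (ltnW jn); have e2 := IHi j.+1 (ltnW iN) jn.
have e3 := IHj (ltnW jn).
rewrite lrS -[- first_bond (shape i j) lo]e1 -[- first_bond (shape i j.+1) lo]e2.
rewrite -[- first_bond (shape i.+1 j) lo]e3.
case: ifP => _; first by rewrite -[in LHS]addn1 PoszD.
by case: leqP => h; apply/esym; [apply/max_idPr|apply/max_idPl]; lia.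
Qed.

End Grid.

(** From the last row and column of the diagram, the rule is undone cell by cell,
from right to left in each row and from the last row to the first. *)
Lemma grid_inj eta0 (n : nat) (b b' : nat -> nat -> bool) :
  lo = - n%:Z -> n%:Z < hi -> confined 0 eta0 ->
  (forall i j j', b i j -> b i j' -> j = j') ->
  (forall i i' j, b i j -> b i' j -> i = i') ->
  (forall i j j', b' i j -> b' i j' -> j = j') ->
  (forall i i' j, b' i j -> b' i' j -> i = i') ->
  (forall j, (j < n)%N -> hor eta0 b n j = hor eta0 b' n j) ->
  (forall i, (i < n)%N -> vert eta0 b i n = vert eta0 b' i n) ->
  forall i j, (i < n)%N -> (j < n)%N -> b i j = b' i j.
Proof.
move=> nlo nhi w0 r1 c1 r2 c2 eh ev.
pose Q i := (forall j, (j < n)%N -> hor eta0 b i j = hor eta0 b' i j) /\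
  shape eta0 b i n = shape eta0 b' i n.
have Qn : Q n.
  split=> //; suff H j : (j <= n)%N -> shape eta0 b n j = shape eta0 b' n j by exact: H.
  elim: j => [//|j IH] jn.
  have E bb : shape eta0 bb n j.+1 = along (hor eta0 bb n j) (shape eta0 bb n j) by [].
  by rewrite !E (eh j jn) IH // ltnW.
have step i : (i < n)%N -> Q i.+1 -> Q i /\ forall j, (j < n)%N -> b i j = b' i j.
  move=> iN [qh qs].
  have sn : shape eta0 b i n = shape eta0 b' i n.
    move: qs; rewrite (shapeS nlo nhi w0 r1 c1) // (shapeS nlo nhi w0 r2 c2) //.
    by rewrite ev // => /along_inj.
  have back j : (j < n)%N -> 
     vert eta0 b i j.+1 = vert eta0 b' i j.+1 ->
     shape eta0 b i j.+1 = shape eta0 b' i j.+1 ->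
     [/\ hor eta0 b i j = hor eta0 b' i j, vert eta0 b i j = vert eta0 b' i j,
       b i j = b' i j & shape eta0 b i j = shape eta0 b' i j].
    move=> jn e1 e2.
    have ch bb : hor eta0 bb i.+1 j =
      (cell (shape eta0 bb i j) (hor eta0 bb i j) (vert eta0 bb i j) (bb i j)).1 by [].
    have cv bb : vert eta0 bb i j.+1 =
      (cell (shape eta0 bb i j) (hor eta0 bb i j) (vert eta0 bb i j) (bb i j)).2 by [].
    have cs bb : shape eta0 bb i j.+1 = along (hor eta0 bb i j) (shape eta0 bb i j) by [].
    have ce : cell (shape eta0 b i j) (hor eta0 b i j) (vert eta0 b i j) (b i j) =
      cell (shape eta0 b' i j) (hor eta0 b' i j) (vert eta0 b' i j) (b' i j).
      by rewrite [LHS]surjective_pairing [RHS]surjective_pairing -!ch -!cv e1 qh.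
    apply: (cell_inj _ _ _ _ _ _ _ _ _ _ ce); rewrite -?cs.
    - exact: (shape_tame nlo nhi w0 r1 c1 (ltnW iN) (ltnW jn)).
    - exact: (shape_tame nlo nhi w0 r1 c1 (ltnW iN) jn).
    - exact: (hor_allowed nlo nhi w0 r1 c1 (ltnW iN) jn).
    - exact: (vert_allowed nlo nhi w0 r1 c1 iN (ltnW jn)).
    - exact: (cell_empty nlo nhi w0 r1 c1 iN jn).
    - exact: (shape_tame nlo nhi w0 r2 c2 (ltnW iN) (ltnW jn)).
    - exact: (shape_tame nlo nhi w0 r2 c2 (ltnW iN) jn).
    - exact: (hor_allowed nlo nhi w0 r2 c2 (ltnW iN) jn).
    - exact: (vert_allowed nlo nhi w0 r2 c2 iN (ltnW jn)).
    - exact: (cell_empty nlo nhi w0 r2 c2 iN jn).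
    by rewrite -!cv e1 e2.
  have all d : (d <= n)%N -> vert eta0 b i (n - d) = vert eta0 b' i (n - d) /\
      shape eta0 b i (n - d) = shape eta0 b' i (n - d).
    elim: d => [|d IH] dn; first by rewrite subn0 ev.
    have [] := IH (ltnW dn).
    have -> : (n - d = (n - d.+1).+1)%N by lia.
    by move=> e1 e2; have [] // := back (n - d.+1)%N _ e1 e2; lia.
  have res j : (j < n)%N -> hor eta0 b i j = hor eta0 b' i j /\ b i j = b' i j.
    move=> jn; have [] := all (n - j.+1)%N; first by lia.
    have -> : (n - (n - j.+1) = j.+1)%N by lia.
    by move=> e1 e2; have [] := back j jn e1 e2.
  by split => [|j /res[]//]; split => // j /res[].
have all d : (d <= n)%N -> Q (n - d)%N.
  elim: d => [|d IH] dn; first by rewrite subn0.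
  have := IH (ltnW dn); have -> : (n - d = (n - d.+1).+1)%N by lia.
  by move/step => []//; lia.
move=> i j iN jn; have q : Q i.+1.
  have := all (n - i.+1)%N; have -> : (n - (n - i.+1) = i.+1)%N by lia.
  by apply; lia.
by have [_ h] := step i iN q; exact: h.
Qed.

End Growth.

(** * Longest increasing subsequences, and the two words of a permutation *)

Section LongestIncreasing.
Variables (n : nat) (s : 'S_n).

(** The permutation matrix, extended by false beyond [n]. *)
Definition graph (i j : nat) : bool :=
  [exists p : 'I_n, (p == i :> nat) && (s p == j :> nat)].

Definition in_box (i j : nat) (A : {set 'I_n}) : bool :=
  [forall p in A, (p < i)%N && (s p < j)%N].

Definition box_lis (i j : nat) : nat :=
  \max_(A : {set 'I_n} | increasing_on s A && in_box i j A) #|A|.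

Lemma increasing_onP (A : {set 'I_n}) :
  reflect (forall p q, p \in A -> q \in A -> (p < q)%N -> (s p < s q)%N)
          (increasing_on s A).
Proof.
apply: (iffP forall_inP) => [h p q pA qA pq|h p pA].
  by have /forall_inP/(_ _ qA)/implyP := h _ pA; exact.
by apply/forall_inP => q qA; apply/implyP; exact: h.
Qed.

Lemma in_boxP i j (A : {set 'I_n}) :
  reflect (forall p, p \in A -> (p < i)%N /\ (s p < j)%N) (in_box i j A).
Proof.
apply: (iffP forall_inP) => h p pA; first by have /andP := h p pA.
by have [-> ->] := h p pA.
Qed.

Lemma graphP i j :
  reflect (exists2 p : 'I_n, i = p :> nat & j = s p :> nat) (graph i j).
Proof.
apply: (iffP existsP) => [[p /andP[/eqP <- /eqP <-]]|[p -> ->]]; exists p => //.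
by rewrite !eqxx.
Qed.

Lemma graph_row i j j' : graph i j -> graph i j' -> j = j'.
Proof. by move=> /graphP[p -> ->] /graphP[q /val_inj -> ->]. Qed.

Lemma graph_col i i' j : graph i j -> graph i' j -> i = i'.
Proof. by move=> /graphP[p -> ->] /graphP[q -> /val_inj/perm_inj ->]. Qed.

Lemma box_lis_le i j m :
  (forall A, increasing_on s A -> in_box i j A -> (#|A| <= m)%N) ->
  (box_lis i j <= m)%N.
Proof. by move=> h; apply/bigmax_leqP => A /andP[]; exact: h. Qed.

Lemma le_box_lis i j (A : {set 'I_n}) :
  increasing_on s A -> in_box i j A -> (#|A| <= box_lis i j)%N.
Proof.
move=> h1 h2.
by apply: (@leq_bigmax_cond _ (fun A =>
  increasing_on s A && in_box i j A) (fun A : {set 'I_n} => #|A|)); rewrite h1.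
Qed.

Lemma box_lis0 j : box_lis 0 j = 0%N.
Proof.
apply/eqP; rewrite -leqn0; apply: box_lis_le => A _ /in_boxP h.
by rewrite leqn0 cards_eq0; apply/set0Pn => -[p /h[]].
Qed.

Lemma box_lis0r i : box_lis i 0 = 0%N.
Proof.
apply/eqP; rewrite -leqn0; apply: box_lis_le => A _ /in_boxP h.
by rewrite leqn0 cards_eq0; apply/set0Pn => -[p /h[]].
Qed.

(** If the corner of the box carries an entry, it extends every increasing set of the
smaller box. If not, an increasing set cannot use both the last row and the last
column: their entries would be two different points, each beyond the other in one
direction. *)
Lemma box_lisS i j : box_lis i.+1 j.+1 =
  if graph i j then (box_lis i j).+1 else maxn (box_lis i j.+1) (box_lis i.+1 j).
Proof.
case: ifP => [/graphP[p ip jp]|/negbT/negP nij]; apply/eqP; rewrite eqn_leq;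
  apply/andP; split.
- apply: box_lis_le => A /increasing_onP iA /in_boxP bA.
  apply: (@leq_trans (#|A :\ p|.+1));
    first by rewrite (cardsD1 p A) addnC -addn1 leq_add2l; case: (_ \in _).
  rewrite ltnS; apply: le_box_lis.
    by apply/increasing_onP => x y /setD1P[_ xA] /setD1P[_ yA]; exact: iA.
  apply/in_boxP => x /setD1P[xp xA]; have [h1 h2] := bA _ xA.
  have h3 : val x <> i by rewrite ip => /val_inj E; rewrite E eqxx in xp.
  have h4 : val (s x) <> j by rewrite jp => /val_inj/perm_inj E; rewrite E eqxx in xp.
  by rewrite /= in h3 h4; split; lia.
- suff : (box_lis i j <= (box_lis i.+1 j.+1).-1)%N /\ (0 < box_lis i.+1 j.+1)%N by lia.
  have addp A : increasing_on s A -> in_box i j A -> (#|A| < box_lis i.+1 j.+1)%N.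
    move=> /increasing_onP iA /in_boxP bA.
    have pA : p \notin A by apply/negP => /bA[]; lia.
    have <- : #|p |: A| = #|A|.+1 by rewrite cardsU1 pA.
    apply: le_box_lis.
      apply/increasing_onP => x y /setU1P[->|xA] /setU1P[->|yA]; last exact: iA.
      + by rewrite ltnn.
      + by have := bA _ yA; lia.
      + by have := bA _ xA; lia.
    by apply/in_boxP => x /setU1P[->|/bA]; lia.
  split; first by apply: box_lis_le => A h1 h2; have := addp _ h1 h2; lia.
  have := addp finset.set0; rewrite cards0; apply.
    by apply/increasing_onP => x y; rewrite inE.
  by apply/in_boxP => x; rewrite inE.
- apply: box_lis_le => A hA /in_boxP bA; have /increasing_onP iA := hA.
  rewrite leq_max.
  case: (boolP [exists p in A, p == i :> nat]) => [/exists_inP[p pA /eqP pi]|np].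
    apply/orP; right; apply: le_box_lis => //; apply/in_boxP => x xA.
    have [h1 h2] := bA _ xA; split => //.
    have sxj : val (s x) <> j.
      move=> sx; case: (ltngtP x p) => xp; last first.
      - by apply: nij; apply/graphP; exists p => //; rewrite -sx; congr (val (s _));
        apply: val_inj.
      - by lia.
      have := iA _ _ xA pA xp; have [_ h3] := bA _ pA.
      by rewrite /= in sx; lia.
    by rewrite /= in sxj; lia.
  apply/orP; left; apply: le_box_lis => //; apply/in_boxP => x xA.
  have [h1 h2] := bA _ xA; split => //.
  suff : val x <> i by rewrite /=; lia.
  by move=> xi; case/exists_inP: np; exists x => //; apply/eqP.
- rewrite geq_max; apply/andP; split; apply: box_lis_le => A iA /in_boxP bA;
  by apply: le_box_lis => //; apply/in_boxP => x /bA[]; lia.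
Qed.

Lemma box_lis_full : box_lis n n = lis s.
Proof.
apply: eq_bigl => A; rewrite (_ : in_box n n A = true) ?andbT //.
by apply/in_boxP => p _; split; exact: ltn_ord.
Qed.

End LongestIncreasing.

Definition run (eta : int -> bool) (w : seq int) := foldl swapped eta w.

Fixpoint valid_word (hi : int) (eta : int -> bool) (w : seq int) : bool :=
  if w is j :: w' then allowed hi (Some j) eta && valid_word hi (swapped eta j) w'
  else true.

Lemma run_rcons eta w j : run eta (rcons w j) = swapped (run eta w) j.
Proof. by rewrite /run foldl_rcons. Qed.

Lemma valid_rcons hi eta w j :
  valid_word hi eta (rcons w j) =
  valid_word hi eta w && allowed hi (Some j) (run eta w).
Proof. by elim: w eta => [|k w IH] eta /=; rewrite ?andbT // IH andbA. Qed.

Lemma chain_word hi (k : nat -> option int) (sh : nat -> int -> bool) n :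
  (forall j, (j < n)%N -> isSome (k j)) ->
  (forall j, (j < n)%N -> allowed hi (k j) (sh j)) ->
  (forall j, (j < n)%N -> sh j.+1 = along (k j) (sh j)) ->
  let w := [seq odflt 0 (k j) | j <- iota 0 n] in
  valid_word hi (sh 0%N) w /\ run (sh 0%N) w = sh n.
Proof.
elim: n => [//|n IH] h1 h2 h3; rewrite -[in iota _ _]addn1 iotaD map_cat cats1 /=.
have [] := IH; [by move=> j jn; apply: h1; lia|by move=> j jn; apply: h2; lia|
  by move=> j jn; apply: h3; lia|].
move=> v r; rewrite valid_rcons run_rcons v r add0n.
have := h1 n (ltnSn n); have := h2 n (ltnSn n); have := h3 n (ltnSn n).
case: (k n) => //= j -> -> _; split.
Qed.

(** The Robinson-Schensted correspondence, as an injection: a permutation goes to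
the pair of words read on the last row and on the last column of its growth diagram. *)
Lemma perm_words (n : nat) (hi : int) (eta0 : int -> bool) :
  n%:Z < hi -> confined hi 0 eta0 ->
  exists f : 'S_n -> seq int * seq int, injective f /\
    forall s, [/\ size (f s).1 = n /\ size (f s).2 = n,
      valid_word hi eta0 (f s).1, valid_word hi eta0 (f s).2,
      run eta0 (f s).1 = run eta0 (f s).2 &
      is_first (run eta0 (f s).1) (- n%:Z) (- (lis s)%:Z)].
Proof.
move=> nhi w0; set lo := - n%:Z.
have lohi : lo < hi by lia.
pose hw (s : 'S_n) := [seq odflt 0 (hor lo hi eta0 (graph s) n j) | j <- iota 0 n].
pose vw (s : 'S_n) := [seq odflt 0 (vert lo hi eta0 (graph s) i n) | i <- iota 0 n].
have hs (s : 'S_n) j : (j < n)%N -> isSome (hor lo hi eta0 (graph s) n j).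
  move=> jn; rewrite (hor_some lohi _ nhi w0 (@graph_row _ s) (@graph_col _ s)) //.
  apply/hasP; exists (val ((s^-1)%g (Ordinal jn))); first by rewrite mem_iota /= ltn_ord.
  by apply/graphP; exists ((s^-1)%g (Ordinal jn)) => //; rewrite permKV.
have vs (s : 'S_n) i : (i < n)%N -> isSome (vert lo hi eta0 (graph s) i n).
  move=> iN; rewrite (vert_some lohi _ nhi w0 (@graph_row _ s) (@graph_col _ s)) //.
  apply/hasP; exists (val (s (Ordinal iN))); first by rewrite mem_iota /= ltn_ord.
  by apply/graphP; exists (Ordinal iN).
exists (fun s => (hw s, vw s)); split.
  move=> s s' [eh ev]; apply/permP => p; apply: val_inj.
  have e1 j : (j < n)%N -> hor lo hi eta0 (graph s) n j = hor lo hi eta0 (graph s') n j.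
    move=> jn; have := congr1 (fun w => nth 0 w j) eh.
    rewrite !(nth_map 0%N) ?size_iota // !nth_iota //.
    by have := hs s j jn; have := hs s' j jn; do 2 case: hor => //= ? ; move=> _ _ ->.
  have e2 i : (i < n)%N -> vert lo hi eta0 (graph s) i n = vert lo hi eta0 (graph s') i n.
    move=> iN; have := congr1 (fun w => nth 0 w i) ev.
    rewrite !(nth_map 0%N) ?size_iota // !nth_iota //.
    by have := vs s i iN; have := vs s' i iN; do 2 case: vert => //= ? ; move=> _ _ ->.
  have := grid_inj lohi erefl nhi w0 (@graph_row _ s) (@graph_col _ s)
    (@graph_row _ s') (@graph_col _ s') e1 e2 (ltn_ord p) (ltn_ord (s p)).
  rewrite (_ : graph s p (s p)); last by apply/graphP; exists p.
  by move=> /esym/graphP[q /val_inj <-].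
move=> s; rewrite /=.
have [v1 r1] := chain_word (hs s) (fun j jn =>
  hor_allowed lohi erefl nhi w0 (@graph_row _ s) (@graph_col _ s) (leqnn n) jn) (fun j
    jn => erefl).
have [v2 r2] := chain_word (vs s) (fun j jn =>
  vert_allowed lohi erefl nhi w0 (@graph_row _ s) (@graph_col _ s) jn (leqnn n))
 (fun j jn => shapeS lohi erefl nhi w0 (@graph_row _ s) (@graph_col _ s) jn (leqnn n)).
have z2 j : shape lo hi eta0 (graph s) 0 j = eta0 by elim: j.
rewrite z2 in v2 r2.
split => //; first by rewrite !size_map !size_iota.
- by rewrite r1 r2.
rewrite r1; have := shape_first lohi erefl nhi w0 (@graph_row _ s) (@graph_col _ s)
  (@box_lis0 _ s) (@box_lis0r _ s) (@box_lisS _ s) (leqnn n) (leqnn n).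
rewrite box_lis_full => E; rewrite (_ : - (lis s)%:Z =
  first_bond hi (shape lo hi eta0 (graph s) n n) lo); last by lia.
have t := shape_tame lohi erefl nhi w0 (@graph_row _ s) (@graph_col _ s) (leqnn n)
  (leqnn n).
by have [] := first_bond_tame lohi t.
Qed.

(** * Hops over a set of bonds, and their commutation relations *)

Section Hops.
Variable N : nat.
Implicit Types (X Y : config N) (j k : int) (c : bool).

Lemma occ_exchangeE j X s : occ (exchange j X) s =
  if s == j then occ X (j + 1) else if s == j + 1 then occ X j else occ X s.
Proof. by rewrite occ_exchange /swap_site; case: ifP => // _; case: ifP. Qed.

Lemma occ_inj X Y : occ X =1 occ Y -> X = Y.
Proof. by move=> h; apply/val_inj/fsetP => s; exact: h. Qed.

Lemma occ_swapped j X : occ (exchange j X) = swapped (occ X) j.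
Proof. by apply/funext => s; rewrite occ_exchange. Qed.

Lemma exchange_comm j k X : (j + 1 < k) || (k + 1 < j) ->
  exchange k (exchange j X) = exchange j (exchange k X).
Proof.
by move=> h; apply: occ_inj => s; rewrite !occ_swapped swapped_comm.
Qed.

Definition edge c j X : bool := (occ X j == c) && (occ X (j + 1) == ~~ c).

Lemma edge_exchange c j X : edge c j (exchange j X) = edge (~~ c) j X.
Proof.
rewrite /edge !occ_exchangeE !eqxx ifF; last by apply/eqP; lia.
by rewrite andbC negbK.
Qed.

(** Overlapping bonds carrying opposite patterns exclude each other in both orders. *)
Lemma edge_comm c j k X : j != k ->
  edge c j X && edge (~~ c) k (exchange j X) =
  edge (~~ c) k X && edge c j (exchange k X).
Proof.
move=> jk; rewrite /edge !occ_exchangeE.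
have e1 : (k == j) = false by rewrite eq_sym; exact: negbTE.
have e2 : (j == k) = false by exact: negbTE.
have e3 : (k + 1 == j + 1) = false by apply/eqP; lia.
have e4 : (j + 1 == k + 1) = false by apply/eqP; lia.
rewrite e1 e2 e3 e4.
case: (eqVneq k (j + 1)) => [E|n1].
  have -> : (k + 1 == j) = false by apply/eqP; lia.
  have -> : (j == k + 1) = false by apply/eqP; lia.
  rewrite -E ?eqxx.
  by case: (occ X k); case: (occ X j); case: (occ X (k + 1)); case: c.
rewrite ?(eq_sym (j + 1)) ?(negbTE n1).
case: (eqVneq j (k + 1)) => [E|n2].
  rewrite -E ?eqxx.
  by case: (occ X k); case: (occ X j); case: (occ X (j + 1)); case: c.
by rewrite andbC.
Qed.

Lemma edge_far c j k X : j != k ->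
  edge c j X -> edge (~~ c) k (exchange j X) -> (j + 1 < k) || (k + 1 < j).
Proof.
move=> jk; rewrite /edge !occ_exchangeE => e1 e2.
have [//|/norP[h1 h2]] := boolP ((j + 1 < k) || (k + 1 < j)).
have [E|E] : k = j + 1 \/ j = k + 1 by lia.
  subst k; move: e1 e2; rewrite eqxx; have -> : (j + 1 == j) = false by lia.
  by case: (occ X j); case: (occ X (j + 1)); case: c; rewrite ?andbF.
subst j; move: e1 e2; rewrite eqxx.
by case: (occ X (k + 1)); case: (occ X (k + 1 + 1)); case: c; rewrite ?andbF.
Qed.

Section Operator.
Variable V : nmodType.
Implicit Types f : config N -> V.

(** The transposed point of view: [hop c B f X] collects the values of [f] at the
configurations from which one jump over a bond of [B] leads to [X], the jump going to
the left for [c = true] and to the right for [c = false]. *)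
Definition hop c (B : seq int) f : config N -> V :=
  fun X => \sum_(j <- B | edge c j X) f (exchange j X).

Lemma hop_comm c (B B' : seq int) f X :
  (forall j k, j \in B -> k \in B' -> j != k) ->
  hop c B (hop (~~ c) B' f) X = hop (~~ c) B' (hop c B f) X.
Proof.
move=> h; rewrite /hop.
under eq_bigr do rewrite big_mkcond.
under [RHS]eq_bigr do rewrite big_mkcond.
rewrite !(big_mkcond (fun _ => edge _ _ _)) /=.
transitivity (\sum_(j <- B) \sum_(k <- B') if edge c j X && edge (~~ c) k (exchange j
  X) then f (exchange k (exchange j X)) else 0).
  by apply: eq_bigr => j _; case: ifP => // _; rewrite big1.
rewrite exchange_big /=; apply: eq_big_seq => k kB.
transitivity (\sum_(j <- B) if edge (~~ c) k X && edge c j (exchange k X) then f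
  (exchange j (exchange k X)) else 0).
  apply: eq_big_seq => j jB; rewrite -edge_comm ?h //.
  case: ifP => // /andP[e1 e2]; rewrite exchange_comm //.
  by apply: edge_far e1 e2; exact: h.
by case: ifP => // _; rewrite big1.
Qed.

Definition bonds (lo hi : int) : seq int :=
  [seq lo + i%:Z | i <- iota 0 (absz (hi - lo)%R)].

Lemma mem_bonds lo hi j : lo <= hi -> (j \in bonds lo hi) = (lo <= j < hi).
Proof.
move=> lh; apply/mapP/idP => [ [i + ->] | h]; first by rewrite mem_iota; lia.
by exists (absz (j - lo)%R); rewrite ?mem_iota; lia.
Qed.

Lemma bonds_uniq lo hi : uniq (bonds lo hi).
Proof. by rewrite map_inj_uniq ?iota_uniq // => i i'; lia. Qed.

(** Along a range of bonds, rises and falls of the occupation alternate. *)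
Lemma edge_balance lo hi X (v : V) : lo <= hi ->
  \sum_(j <- bonds lo hi | edge false j X) v + v *+ occ X lo =
  \sum_(j <- bonds lo hi | edge true j X) v + v *+ occ X hi.
Proof.
move=> lh; have -> : hi = lo + (absz (hi - lo)%R)%:Z by lia.
rewrite /bonds (_ : lo + _ - lo = (absz (hi - lo)%R)%:Z) ?absz_nat; last by lia.
elim: (absz _) => [|d IH]; first by rewrite addr0 !big_nil.
rewrite -[in iota _ _]addn1 iotaD map_cat !big_cat !big_cons !big_nil /= add0n.
rewrite addrAC IH -!addrA; congr (_ + _); rewrite /edge.
have -> : lo + d.+1%:Z = lo + d%:Z + 1 by lia.
by case: (occ X (lo + d)); case: (occ X (_ + 1)); rewrite /= ?mulr1n ?mulr0n ?addr0 ?add0r.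
Qed.

(** The relation [D U - U D = 1] of Young's lattice. Jumps over distinct bonds
commute, and jumping back over the same bond counts the rises, or the falls, of the
occupation; their difference only depends on the two ends of the range. *)
Lemma hop_commutator lo hi f X : lo <= hi ->
  hop false (bonds lo hi) (hop true (bonds lo hi) f) X + f X *+ occ X lo =
  hop true (bonds lo hi) (hop false (bonds lo hi) f) X + f X *+ occ X hi.
Proof.
move=> lh; set B := bonds lo hi.
pose off c (u v : int) (Z : config N) :=
  if (u != v) && (edge c u X && edge (~~ c) v (exchange u X)) then f (exchange v
    (exchange u X)) else 0.
have dec c : hop c B (hop (~~ c) B f) X =
    \sum_(j <- B | edge c j X) f X + \sum_(j <- B) \sum_(k <- B) off c j k X.
  rewrite /hop (big_mkcond (fun _ => edge _ _ _)) [X in _ =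
    X + _](big_mkcond (fun _ => edge _ _ _)) -big_split /=.
  apply: eq_big_seq => j jB; case: ifP => e; last first.
    by rewrite add0r big1 // /off => k _; rewrite e /= andbF.
  rewrite big_mkcond (bigD1_seq j) ?bonds_uniq //=.
  rewrite edge_exchange negbK e exchangeK; congr (_ + _).
  rewrite big_mkcond; apply: eq_bigr => k _; rewrite /off e /= eq_sym.
  by case: eqP.
rewrite (dec false) (dec true) /= -!addrA ![_ + f X *+ _]addrC !addrA edge_balance //.
congr (_ + _); rewrite exchange_big; apply: eq_bigr => j _; apply: eq_bigr => k _.
rewrite /off eq_sym; case: eqP => //= /eqP jk; rewrite (edge_comm false) ?(eq_sym k) //.
case: ifP => // /andP[e1 e2]; rewrite exchange_comm //.
by rewrite orbC; apply: edge_far e1 e2.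
Qed.

Lemma hop_ext c B f f' : f =1 f' -> hop c B f =1 hop c B f'.
Proof. by move=> h X; apply: eq_bigr => j _; rewrite h. Qed.

End Operator.
End Hops.

(** * The two ends of the block as commuting ladders *)

Lemma occ_step N (s : int) : occ (step_config N) s = (0 < s <= N%:Z).
Proof.
rewrite /occ /= inE /=; apply/mapP/idP => [ [i + ->] | h].
  by rewrite mem_iota; lia.
by exists (absz s); rewrite ?mem_iota; lia.
Qed.

Section Ladder.
Variables (N : nat) (m K : int).
Hypotheses (Km : K < m) (mKN : m + K <= N%:Z) (K0 : 0 <= K).
Implicit Types (X Y : config N) (j k : int) (c : bool).

Definition left_bonds := bonds (- K) m.
Definition right_bonds := bonds m (N%:Z + 1 + K).

Lemma mem_left j : (j \in left_bonds) = (- K <= j < m).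
Proof. by apply: mem_bonds; lia. Qed.

Lemma mem_right j : (j \in right_bonds) = (m <= j < N%:Z + 1 + K).
Proof. by apply: mem_bonds; lia. Qed.

Definition origin : config N -> nat := fun X => nat_of_bool (X == step_config N).

(** [spread a b X] counts the pairs of a left word of length [a] and a right word of
length [b] that lead from the block to [X]. *)
Definition spread (a b : nat) : config N -> nat :=
  iter a (hop true left_bonds) (iter b (hop false right_bonds) origin).

(** What [a] moves at the left end and [b] at the right end can reach. *)
Definition confined_both (a b : nat) X : Prop :=
  [/\ forall s, s <= - a%:Z -> ~~ occ X s,
      forall s, a%:Z < s <= N%:Z - b%:Z -> occ X s &
      forall s, N%:Z + b%:Z < s -> ~~ occ X s].

Lemma hop_neq0 (V : nmodType) c B (f : config N -> V) X : hop c B f X != 0 ->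
  exists j, [/\ j \in B, edge c j X & f (exchange j X) != 0].
Proof.
apply: contraNP => h; rewrite /hop big_seq_cond big1 // => j /andP[jB ej].
by apply/eqP/negP => /negP fj; apply: h; exists j.
Qed.

Lemma spread_confined a b X : (a%:Z <= K) -> (b%:Z <= K) ->
  spread a b X != 0%N -> confined_both a b X.
Proof.
elim: a X => [|a IH] X aK bK; last first.
  case/hop_neq0 => j [jB ej nz]; move: jB; rewrite mem_left => jB.
  have aK' : a%:Z <= K by lia.
  have [h1 h2 h3] := IH _ aK' bK nz.
  have [ej0 ej1] : occ X j /\ ~~ occ X (j + 1).
    by move/andP: ej => [/eqP -> /eqP ->].
  have jj : (j + 1 == j) = false by lia.
  have ja : - a%:Z <= j.
    case: (leP (- a%:Z) j) => // ja; have := h1 (j + 1); rewrite occ_exchangeE eqxx jj ej0.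
    by move=> /(_ _)/negP[] //; lia.
  have ja' : j <= a%:Z.
    case: (leP j a%:Z) => // ja'; have := h2 j; rewrite occ_exchangeE eqxx (negbTE ej1).
    by move=> /(_ _)/negP[] //; lia.
  split => s hs.
  - have := h1 s; rewrite occ_exchangeE; case: eqP => [?|_]; first by lia.
    by case: eqP => [?|_]; [lia|apply; lia].
  - have := h2 s; rewrite occ_exchangeE; case: eqP => [?|_]; first by lia.
    by case: eqP => [?|_]; [lia|apply; lia].
  - have := h3 s; rewrite occ_exchangeE; case: eqP => [?|_]; first by lia.
    by case: eqP => [?|_]; [lia|apply; lia].
elim: b X bK => [|b IH] X bK.
  rewrite /spread /= /origin eqb0 negbK => /eqP ->; split => s hs; rewrite occ_step; lia.
case/hop_neq0 => j [jB ej nz]; move: jB; rewrite mem_right => jB.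
have bK' : b%:Z <= K by lia.
have [h1 h2 h3] := IH _ bK' nz.
have [ej0 ej1] : ~~ occ X j /\ occ X (j + 1).
  by move/andP: ej => [/eqP -> /eqP ->].
have jj : (j + 1 == j) = false by lia.
have ja : N%:Z - b%:Z <= j.
  case: (leP (N%:Z - b%:Z) j) => // ja; have := h2 (j + 1);
    rewrite occ_exchangeE eqxx jj (negbTE ej0).
  by move=> /(_ _)/negP[] //; lia.
have ja' : j <= N%:Z + b%:Z.
  case: (leP j (N%:Z + b%:Z)) => // ja'; have := h3 j; rewrite occ_exchangeE eqxx ej1.
  by move=> /(_ _)/negP[] //; lia.
split => s hs.
- have := h1 s; rewrite occ_exchangeE; case: eqP => [?|_]; first by lia.
  by case: eqP => [?|_]; [lia|apply; lia].
- have := h2 s; rewrite occ_exchangeE; case: eqP => [?|_]; first by lia.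
  by case: eqP => [?|_]; [lia|apply; lia].
- have := h3 s; rewrite occ_exchangeE; case: eqP => [?|_]; first by lia.
  by case: eqP => [?|_]; [lia|apply; lia].
Qed.

(** Moves at the two ends commute: they use disjoint sets of bonds, with opposite
directions. *)
Lemma spreadC a b : spread a b =1
  iter b (hop false right_bonds) (iter a (hop true left_bonds) origin).
Proof.
have comm f X : hop true left_bonds (hop false right_bonds f) X =
   hop false right_bonds (hop true left_bonds f) X :> nat.
  apply: (@hop_comm _ _ true) => j k; rewrite mem_left mem_right => ? ?; lia.
have comm1 b' f X : hop true left_bonds (iter b' (hop false right_bonds) f) X =
   iter b' (hop false right_bonds) (hop true left_bonds f) X :> nat.
  elim: b' f X => [//|b' IH] f X; rewrite iterS comm iterS.
  exact: hop_ext.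
rewrite /spread; elim: a => [//|a IH] X.
by rewrite iterS (hop_ext _ _ IH) comm1.
Qed.

(** The harmonic oscillator computation [D U^(n+1) F = (n+1) U^n F], for a vacuum
[F]; the hypothesis on the supports says that the commutator is the identity on all
the vectors involved. *)
Lemma ladder c lo hi (F : config N -> nat) n : lo <= hi ->
  (forall i X, (i <= n)%N -> iter i (hop c (bonds lo hi)) F X != 0%N ->
      occ X lo = ~~ c /\ occ X hi = c) ->
  hop (~~ c) (bonds lo hi) F =1 (fun=> 0%N) ->
  hop (~~ c) (bonds lo hi) (iter n.+1 (hop c (bonds lo hi)) F) =1
  (fun X => n.+1 * iter n (hop c (bonds lo hi)) F X)%N.
Proof.
move=> lh; set U := hop c _; set D := hop (~~ c) _ => supp DF.
have one (f : config N -> nat) X : (f X != 0%N -> occ X lo = ~~ c /\ occ X hi = c) ->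
   D (U f) X = (U (D f) X + f X)%N.
  move=> h; have := hop_commutator f X lh; rewrite -/U -/D.
  have [->|/h[]] := eqVneq (f X) 0%N.
    by rewrite !mul0rn !addr0 /U /D; case: (c) => /= ->; rewrite addn0.
  rewrite /U /D; case: (c) => /= -> ->; rewrite mulr0n mulr1n !addr0.
    by move=> ->.
  by move=> <-.
elim: n supp => [|n IH] supp X.
  rewrite /= one; last exact: (supp 0%N X).
  rewrite (_ : U (D F) X = 0%N) ?mul1n //.
  by rewrite /U /hop big1 // => j _; rewrite DF.
rewrite iterS (one (iter n.+1 U F) X (supp n.+1 X (leqnn _))).
have := IH (fun i X le => supp i X (leqW le)) => {}IH.
rewrite (_ : U (D (iter n.+1 U F)) X = (n.+1 * U (iter n U F) X)%N);
  first by rewrite mulSn addnC.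
transitivity (U (fun Z => n.+1 * iter n U F Z)%N X); first exact: hop_ext.
by rewrite /U /hop big_distrr.
Qed.

Lemma left_lower a b : a%:Z <= K -> b%:Z <= K ->
  hop false left_bonds (spread a b) =1
  (fun X => if a is a'.+1 then (a * spread a' b X)%N else 0%N).
Proof.
move=> aK bK.
have D0 : hop false left_bonds (spread 0 b) =1 (fun=> 0%N).
  move=> X; apply/eqP; apply/negP => /negP/hop_neq0[j []]; rewrite mem_left => jm ej.
  case/spread_confined => // h1 h2 h3; move/andP: ej => [/eqP e0 /eqP e1].
  have := h1 j; have := h2 (j + 1); rewrite !occ_exchangeE !eqxx e0 e1.
  have -> : (j + 1 == j) = false by lia.
  case: (leP j 0) => j0; last by move=> /(_ _); lia.
  by move=> _ /(_ _); lia.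
case: a aK => [|a] aK X; first exact: D0.
rewrite {1}/spread; apply: (ladder (c := true)) => //; first by lia.
move=> i Y ia nz; have [||h1 h2 h3] := @spread_confined i b Y _ _ nz; try lia.
by split; [apply/negbTE/h1; lia|apply: h2; lia].
Qed.

Lemma right_lower a b : a%:Z <= K -> b%:Z <= K ->
  hop true right_bonds (spread a b) =1
  (fun X => if b is b'.+1 then (b * spread a b' X)%N else 0%N).
Proof.
move=> aK bK.
have D0 : hop true right_bonds (spread a 0) =1 (fun=> 0%N).
  move=> X; apply/eqP; apply/negP => /negP/hop_neq0[j []]; rewrite mem_right => jm ej.
  case/spread_confined => // h1 h2 h3; move/andP: ej => [/eqP e0 /eqP e1].
  have := h2 j; have := h3 (j + 1); rewrite !occ_exchangeE !eqxx e0 e1.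
  have -> : (j + 1 == j) = false by lia.
  case: (leP j N%:Z) => j0; last by move=> /(_ _); lia.
  by move=> _ /(_ _); lia.
case: b bK => [|b] bK X; first exact: D0.
rewrite (hop_ext _ _ (spreadC a b.+1)) spreadC.
apply: (ladder (c := false)) => //; first by lia.
  move=> i Y ia; rewrite -spreadC => nz; have [||h1 h2 h3] :=
    @spread_confined a i Y _ _ nz; try lia.
  by split; [apply: h2; lia|apply/negbTE/h3; lia].
Qed.

End Ladder.

Section InnerProduct.
Variables (R : realType) (N : nat).
Implicit Types (X Y : config N) (f g : config N -> nat) (S : set (config N)).

Definition overlap S f g : \bar R := \esum_(X in S) ((f X * g X)%N%:R)%:E.

Lemma overlap_ext S f f' g g' : f =1 f' -> g =1 g' -> overlap S f g = overlap S f' g'.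
Proof. by move=> h h'; apply: eq_esum => X _; rewrite h h'. Qed.

Lemma overlapZ S f g (n : nat) :
  overlap S f (fun X => n * g X)%N = (n%:R%:E * overlap S f g)%E.
Proof.
elim: n => [|n IH].
  by rewrite mul0e /overlap esum1 // => X _; rewrite mul0n muln0.
rewrite -[in RHS]natr1 EFinD ge0_muleDl ?lee_fin // -IH mul1e -esumD.
- by apply: eq_esum => X _; rewrite -EFinD -natrD mulSn mulnDr addnC.
- by move=> X _; rewrite lee_fin.
- by move=> X _; rewrite lee_fin.
Qed.

(** Exchanging the occupations of two sites is an involution of the configurations
that turns left jumps into right jumps. *)
Lemma hop_adjoint S c B f g :
  (forall j X, j \in B -> S X -> S (exchange j X)) ->
  overlap S (hop c B f) g = overlap S f (hop (~~ c) B g).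
Proof.
move=> inv.
transitivity (\sum_(j <- B) \esum_(X in S) ((if edge c j X then f (exchange j X) * g X
  else 0)%N%:R : R)%:E)%E.
  rewrite -esum_sum; last by move=> X j _ _; rewrite lee_fin.
  apply: eq_esum => X _; rewrite sumEFin -natr_sum; congr (_%:R%:E).
  by rewrite /hop [LHS]big_distrl /= big_mkcond.
transitivity (\sum_(j <- B) \esum_(X in S) ((if edge (~~ c) j X then f X * g (exchange
  j X) else 0)%N%:R : R)%:E)%E; last first.
  rewrite -esum_sum; last by move=> X j _ _; rewrite lee_fin.
  apply: eq_esum => X _; rewrite sumEFin -natr_sum; congr (_%:R%:E).
  by rewrite /hop [RHS]big_distrr /= [RHS]big_mkcond.
apply: eq_big_seq => j jB.
rewrite (reindex_esum S S (@exchange N j)).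
  by apply: eq_esum => X _; rewrite edge_exchange exchangeK.
split; first by move=> X /inv; exact.
  by move=> X Y _ _ /(can_inj (exchangeK j)).
by move=> X SX; exists (exchange j X); [exact: inv|rewrite exchangeK].
Qed.

Variables (m K : int).
Hypotheses (Km : K < m) (mKN : m + K <= N%:Z) (K0 : 0 <= K).

(** The usual [||U^b F||^2 = b! ||F||^2], restricted to a set that moves at the right
end preserve. *)
Lemma spread_norm_right S a b : a%:Z <= K -> b%:Z <= K ->
  (forall j X, m <= j -> S X -> S (exchange j X)) ->
  overlap S (spread m K a b) (spread m K a b) =
  ((b`!)%:R%:E * overlap S (@spread N m K a 0) (spread m K a 0))%E.
Proof.
move=> aK + inv; elim: b => [|b IH] bK; first by rewrite fact0 mul1e.
have E : @spread N m K a b.+1 =1 hop false (right_bonds N m K) (spread m K a b).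
  by move=> X; rewrite spreadC // iterS; apply: hop_ext => Z; rewrite spreadC.
rewrite (overlap_ext _ E (fun _ => erefl)) hop_adjoint; last first.
  by move=> j X; rewrite mem_right // => /andP[mj _]; exact: inv.
rewrite (overlap_ext _ (fun _ => erefl) (right_lower Km mKN K0 aK bK)).
rewrite overlapZ IH; last by lia.
by rewrite factS natrM EFinM muleA.
Qed.

Lemma spread_norm_left a : a%:Z <= K ->
  overlap setT (spread m K a 0) (@spread N m K a 0) = (a`!)%:R%:E.
Proof.
elim: a => [|a IH] aK.
  rewrite /spread /= /overlap (esumID [set step_config N]) //.
  rewrite !setTI esum_set1 /origin ?lee_fin // eqxx esum1 ?adde0 //.
  by move=> X /eqP/negbTE ->.
have E : @spread N m K a.+1 0 =1 hop true (left_bonds m K) (spread m K a 0) by [].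
rewrite (overlap_ext _ E (fun _ => erefl)) hop_adjoint //.
rewrite (overlap_ext _ (fun _ => erefl) (left_lower Km mKN K0 aK K0)).
by rewrite overlapZ IH ?factS ?natrM ?EFinM //; lia.
Qed.

End InnerProduct.

(** * Pairs of words with the same end, and permutations *)

Lemma sum_pred1 (T : eqType) (r : seq T) (P : pred T) :
  (\sum_(x <- r) (P x : nat))%N = count P r.
Proof. by elim: r => [|x r IH]; rewrite ?big_nil // big_cons IH. Qed.

Lemma leftmost_first N (X : config N) (p c : int) :
  is_first (occ X) p c -> (forall s, s <= p -> ~~ occ X s) ->
  leftmost X = c + 1.
Proof.
move=> [pc oc h] h'; rewrite /leftmost.
have srt : sorted <=%R (sort <=%R (enum_fset (val X))).
  by apply: sort_sorted; exact: le_total.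
have mem s : (s \in sort <=%R (enum_fset (val X))) = occ X s by rewrite mem_sort.
move: srt mem; case: (sort _ _) => [|y r] srt mem.
  by have := mem (c + 1); rewrite oc.
rewrite /=; have yX : occ X y by rewrite -mem mem_head.
have : c + 1 \in y :: r by rewrite mem oc.
rewrite inE => /orP[/eqP //|cr].
have yc : y <= c + 1.
  by move: srt => /= /(order_path_min le_trans)/allP/(_ _ cr).
case: (ltrgtP y (c + 1)) yc => // yc _; exfalso.
case: (leP y p) => yp; first by have := h' _ yp; rewrite yX.
by have := h y; rewrite yX => /(_ _)/negP[] //; lia.
Qed.

Section Words.
Variables (R : realType) (N : nat) (m K : int).
Hypotheses (Km : K < m) (mKN : m + K <= N%:Z) (K0 : 0 <= K).

Definition crun (w : seq int) : config N :=
  foldl (fun X j => exchange j X) (step_config N) w.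

Lemma occ_crun w : occ (crun w) = run (occ (step_config N)) w.
Proof.
rewrite /crun; elim: w (step_config N) => [//|j w IH] X /=.
by rewrite IH occ_swapped.
Qed.

Lemma crun_rcons w j : crun (rcons w j) = exchange j (crun w).
Proof. by rewrite /crun foldl_rcons. Qed.

Fixpoint words (a : nat) : seq (seq int) :=
  if a is a'.+1 then
    [seq rcons w j | w <- words a',
       j <- [seq j <- left_bonds m K | edge false j (crun w)]]
  else [:: [::]].

(** By confinement, a word of length at most [K] only uses bonds of the range. *)
Lemma valid_words w : (size w)%:Z <= K -> valid_word m (occ (step_config N)) w ->
  w \in words (size w) /\ confined m (size w) (occ (crun w)).
Proof.
elim/last_ind: w => [|w j IH].
  by move=> _ _; split => //; split => s hs; rewrite occ_step; lia.
rewrite size_rcons valid_rcons => szK /andP[vw aj].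
have [|wW cw] := IH _ vw; first by lia.
rewrite -occ_crun in aj.
split; last first.
  rewrite crun_rcons occ_swapped -addn1 PoszD.
  have lohi : - K < m by lia.
  exact: (confined_along (k := Some j) lohi cw aj).
apply/allpairsPdep; exists w, j; split => //.
move: aj => /and3P[jm ej ej1]; rewrite mem_filter /edge (negbTE ej) ej1 /=.
rewrite (mem_left Km mKN K0) jm andbT; case: (leP (- K) j) => // jK.
by move: ej1; rewrite (negbTE (cw.1 _ _)) //; lia.
Qed.

Lemma spread_words a X : spread m K a 0 X = count (fun w => crun w == X) (words a).
Proof.
elim: a X => [|a IH] X; first by rewrite /spread /= /origin addn0 eq_sym.
have -> : spread m K a.+1 0 X = hop true (left_bonds m K) (spread m K a 0) X by [].
rewrite -sum_pred1 [RHS]big_allpairs_dep /hop.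
transitivity (\sum_(j <- left_bonds m K | edge true j X)
    \sum_(w <- words a) (crun w == exchange j X : nat))%N.
  by apply: eq_bigr => j _; rewrite IH sum_pred1.
rewrite exchange_big /=; apply: eq_bigr => w _.
rewrite big_filter big_mkcond [RHS]big_mkcond; apply: eq_big_seq => j jB.
rewrite crun_rcons; case: eqP => [->|ne].
  by rewrite edge_exchange exchangeK eqxx.
case: eqP => [E|_]; last by rewrite !if_same.
by case: ne; rewrite -E exchangeK.
Qed.

Definition word_pairs (P : pred (config N)) a : seq (seq int * seq int) :=
  [seq p <- [seq (w, w') | w <- words a, w' <- words a] |
     (crun p.1 == crun p.2) && P (crun p.1)].

Lemma overlap_words (P : pred (config N)) a :
  overlap R [set X | P X] (spread m K a 0) (spread m K a 0) =
  (size (word_pairs P a))%:R%:E.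
Proof.
rewrite /overlap esum_mkcond.
transitivity (\esum_(X in [set: config N]) \sum_(w <- words a) \sum_(w' <- words a)
   (((crun w == X) && (crun w' == X) && P X)%:R : R)%:E)%E.
  apply: eq_esum => X _.
  have -> : (X \in [set X | P X]) = P X by apply/idP/idP; rewrite inE.
  transitivity (((count (fun w => crun w == X) (words a) * count (fun w =>
    crun w == X) (words a) * P X)%N)%:R%:E : \bar R).
    rewrite !spread_words; case: (P X); rewrite ?muln1 ?muln0 //.
  rewrite -!sum_pred1 big_distrl big_distrl natr_sum -sumEFin; apply: eq_bigr => w _.
  rewrite big_distrr big_distrl natr_sum -sumEFin; apply: eq_bigr => w' _.
  by rewrite /= !mulnb.
rewrite esum_sum; last by move=> *; apply: sume_ge0 => *; rewrite lee_fin.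
rewrite size_filter -sum_pred1 natr_sum -sumEFin [RHS]big_allpairs.
apply: eq_bigr => w _.
rewrite esum_sum; last by move=> *; rewrite lee_fin.
apply: eq_bigr => w' _ /=.
rewrite (esumID [set crun w]) //.
rewrite !setTI esum_set1 ?lee_fin // eqxx /= [crun w' == _]eq_sym esum1 ?adde0 //.
by move=> X /eqP; rewrite eq_sym => /negbTE ->.
Qed.

(** The permutations inject into pairs of words, both for the event and for its
complement; since there are [a!] pairs in all, both injections are onto. *)
Lemma left_norm (x : int) (a : nat) : a%:Z <= K ->
  overlap R [set X | x <= leftmost X] (@spread N m K a 0) (spread m K a 0) =
  (#|[pred s : 'S_a | (lis s)%:Z <= 1 - x]|)%:R%:E.
Proof.
move=> aK; rewrite (overlap_words (fun X => x <= leftmost X)); congr (_%:R%:E).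
have [||f [f_inj fP]] := @perm_words a m (occ (step_config N)).
- by lia.
- by split => s hs; rewrite occ_step; lia.
pose P (X : config N) := x <= leftmost X.
have PE s : P (crun (f s).1) = ((lis s)%:Z <= 1 - x).
  have [[z1 z2] v1 v2 e12 fst] := fP s.
  have [|_ c1] := valid_words _ v1; first by rewrite z1.
  rewrite -occ_crun in fst; rewrite z1 in c1.
  by rewrite /P (leftmost_first fst c1.1); lia.
have le (Q : pred (config N)) :
    (#|[pred s : 'S_a | Q (crun (f s).1)]| <= size (word_pairs Q a))%N.
  rewrite cardE -(size_map f); apply: uniq_leq_size.
    by rewrite map_inj_uniq ?enum_uniq.
  move=> p /mapP[s]; rewrite mem_enum inE => Qs ->.
  have [[z1 z2] v1 v2 e12 fst] := fP s.
  have [|w1 _] := valid_words _ v1; first by rewrite z1.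
  have [|w2 _] := valid_words _ v2; first by rewrite z2.
  rewrite mem_filter Qs andbT; apply/andP; split.
    by apply/eqP/occ_inj => j; rewrite !occ_crun e12.
  rewrite z1 in w1; rewrite z2 in w2.
  by apply/allpairsP; exists (f s); split => //; exact: surjective_pairing.
have tot : (size (word_pairs P a) + size (word_pairs (predC P) a) = a`!)%N.
  have := overlap_words predT a.
  rewrite (_ : [set X | predT X] = setT); last by apply/seteqP; split.
  rewrite spread_norm_left // => -[/eqP]; rewrite eqr_nat => /eqP ->.
  rewrite !size_filter; elim: [seq _ | _ <- _, _ <- _] => [//|p r IH] /=.
  by rewrite -IH; case: (_ == _) => //=; case: (P _) => //=; lia.
rewrite (@eq_card _ [pred s : 'S_a | (lis s)%:Z <=
  1 - x] [pred s : 'S_a | P (crun (f s).1)]); last first.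
  by move=> s; rewrite !inE PE.
have h1 := le P; have h2 := le (predC P).
have h3 := cardC [pred s : 'S_a | P (crun (f s).1)].
rewrite card_Sn -tot in h3.
rewrite (@eq_card _ [predC [pred s : 'S_a | P (crun (f s).1)]] [pred s : 'S_a | predC P
  (crun (f s).1)]) // in h3.
apply/eqP; rewrite eqn_leq h1 andbT -(leq_add2r (size (word_pairs (predC P) a))) -h3.
by rewrite leq_add2l.
Qed.

End Words.

(** * Walks of the Hamiltonian *)

Section Walks.
Variable N : nat.
Implicit Types (X Y : config N) (j k : int) (c : bool).

(** Only bonds that touch a particle can be active, which makes the list finite. *)
Definition active X : seq int :=
  [seq j <- undup (enum_fset (val X) ++ [seq y - 1 | y <- enum_fset (val X)]) |
     occ X j (+) occ X (j + 1)].

Lemma mem_active X j : (j \in active X) = occ X j (+) occ X (j + 1).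
Proof.
rewrite mem_filter; case: (boolP (_ (+) _)) => // h.
rewrite /= mem_undup mem_cat; apply/idP; have [oj|oj] := boolP (occ X j);
  first by apply/orP; left.
apply/orP; right; apply/mapP; exists (j + 1); last by lia.
by move: h; rewrite (negbTE oj).
Qed.

Lemma active_uniq X : uniq (active X).
Proof. by rewrite filter_uniq // undup_uniq. Qed.

Lemma active_edge X j : (j \in active X) = edge true j X || edge false j X.
Proof. by rewrite mem_active /edge; case: (occ X j); case: (occ X (j + 1)). Qed.

Lemma H_XXZ0 (R : realType) (f : config N -> R[i]) X :
  H_XXZ 0 f X = \sum_(j <- active X) f (exchange j X).
Proof.
rewrite /H_XXZ -(fsbig_widen [set` active X] setT) //; last first.
  move=> j /= [_ nj]; rewrite /bond ifF //; apply/negbTE/negP => h.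
  by apply: nj; rewrite mem_active.
rewrite -fsbig_seq ?active_uniq //; apply: eq_big_seq => j.
by rewrite mem_active /bond => ->; rewrite oppr0 mul0r add0r.
Qed.

(** Steps being symmetric, this is the number of walks of length [n] from the block to
[X], that is the coefficient at [X] of the [n]-th power of the Hamiltonian
([walksE]). *)
Fixpoint walks (n : nat) : config N -> nat :=
  if n is n'.+1 then fun X => (\sum_(j <- active X) walks n' (exchange j X))%N
  else @origin N.

Lemma walksE (R : realType) n X :
  iter n (@H_XXZ R 0 N) (Defs.basis (step_config N)) X = (walks n X)%:R.
Proof.
elim: n X => [|n IH] X; first by rewrite /= /Defs.basis /origin eq_sym.
rewrite iterS H_XXZ0 natr_sum; apply: eq_bigr => j _; exact: IH.
Qed.

Definition weight (kappa : int -> nat) X : nat :=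
  (\sum_(p <- enum_fset (val X)) kappa p)%N.

(** One particle jumps over the bond, and the others do not move. *)
Lemma weight_exchange kappa c j X : edge c j X ->
  (weight kappa (exchange j X) + kappa (if c then j else (j + 1)%R) =
   weight kappa X + kappa (if c then (j + 1)%R else j))%N.
Proof.
move=> e; set src := if c then j else j + 1; set dst := if c then j + 1 else j.
have [so dn] : occ X src /\ ~~ occ X dst.
  move: e; rewrite /edge /src /dst; case: (c) => /andP[/eqP e1 /eqP e2];
  by rewrite e1 e2.
have sd : swap_site j src = dst.
  by rewrite /src /dst /swap_site; case: (c); rewrite ?eqxx // ifF //; apply/eqP; lia.
rewrite /weight /exchange /= big_imfset /=; last first.
  by move=> p q _ _ /(can_inj (swap_siteK j)).
rewrite (big_fsetD1 src) //= [in RHS](big_fsetD1 src) //= sd.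
rewrite addnAC [in RHS]addnAC [X in (X + _)%N = _]addnC; congr (_ + _)%N.
apply: eq_big_seq => p; rewrite !inE => /andP[ps pX].
have pd : p != dst by apply: contraNN dn => /eqP <-.
by congr kappa; move: ps pd; rewrite /src /dst /swap_site; case: (c); do ! case: eqP => //.
Qed.

(** The distance to the interval {1, ..., N}. *)
Definition excursion (p : int) : nat :=
  if p <= 0 then absz (1 - p)%R else if N%:Z < p then absz (p - N%:Z)%R else 0%N.

Lemma excursion_step p : (excursion (p + 1)%R <= (excursion p).+1)%N /\
  (excursion p <= (excursion (p + 1)%R).+1)%N.
Proof. by rewrite /excursion; do ! case: ifP => ?; split; lia. Qed.

(** One step moves one particle by one site, and the distance is 1-Lipschitz. *)
Lemma walks_excursion n X : walks n X != 0%N -> (weight excursion X <= n)%N.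
Proof.
elim: n X => [|n IH] X.
  rewrite /= /origin eqb0 negbK => /eqP ->; rewrite leqn0 /weight big_seq big1 //.
  move=> p pY; have : occ (step_config N) p by [].
  by rewrite occ_step /excursion => h; do ! (case: ifP => ?); lia.
rewrite /= => nz.
have [j jX nz'] : exists2 j, j \in active X & walks n (exchange j X) != 0%N.
  have [//|h] := pselect (exists2 j, j \in active X & walks n (exchange j X) != 0%N).
  case/negP: nz; apply/eqP; rewrite big_seq big1 // => j jX.
  by apply/eqP/negP => /negP nj; apply: h; exists j.
have le := IH _ nz'; have [ex1 ex2] := excursion_step j.
move: jX; rewrite active_edge => /orP[e|e];
  have := weight_exchange excursion e; rewrite /=;
  move: le ex1 ex2; move: (weight _ _) (weight _ _) (excursion _) (excursion _);
  by move=> a b c d; lia.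
Qed.

Lemma weight_ge kappa X p : occ X p -> (kappa p <= weight kappa X)%N.
Proof. by move=> pX; rewrite /weight (big_fsetD1 p) //= leq_addr. Qed.

Lemma walks_window n X j : walks n (exchange j X) != 0%N -> j \in active X ->
  - n%:Z <= j < N%:Z + 1 + n%:Z.
Proof.
move=> /walks_excursion le jX.
have [p op pj] : exists2 p, occ (exchange j X) p & p = j \/ p = j + 1.
  move: jX; rewrite mem_active; have [oj _|oj /= oj1] := boolP (occ X j).
    by exists (j + 1); [rewrite occ_exchangeE eqxx; case: eqP => // ?; lia|right].
  by exists j; [rewrite occ_exchangeE eqxx|left].
have := leq_trans (weight_ge excursion op) le.
by rewrite /excursion; do ! (case: ifP => ?); lia.
Qed.

(** Walks of length [n] stay within distance [n] of the block, hence any range of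
bonds that contains this neighbourhood gives all the steps. *)
Lemma walks_hop n X (B : seq int) : uniq B ->
  (forall j, - n%:Z <= j < N%:Z + 1 + n%:Z -> j \in B) ->
  walks n.+1 X = (hop true B (walks n) X + hop false B (walks n) X)%N.
Proof.
move=> uB hB.
have -> : walks n.+1 X = (\sum_(j <- B | j \in active X) walks n (exchange j X))%N.
  rewrite /= -[RHS]big_filter.
  rewrite (bigID (mem B)) /= [X in (_ + X)%N]big1_seq ?addn0; last first.
    move=> j /andP[nB jX]; apply/eqP/negP => /negP nz.
    by case/negP: nB; apply: hB; exact: walks_window nz jX.
  rewrite -big_filter; apply: perm_big; apply: uniq_perm.
  - by rewrite filter_uniq // active_uniq.
  - by rewrite filter_uniq.
  by move=> j; rewrite !mem_filter andbC.
rewrite /hop [in RHS]big_mkcond [X in (_ + X)%N]big_mkcond -big_split /= big_mkcond.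
apply: eq_bigr => j _; rewrite active_edge /edge.
by case: (occ X j); case: (occ X (j + 1)); rewrite /= ?addn0.
Qed.

Lemma card_near (s : nat) (r : seq int) : uniq r ->
  (forall p, p \in r -> (0 < excursion p <= s)%N) -> (size r <= 2 * s)%N.
Proof.
move=> ur h.
pose near := [seq - i%:Z | i <- iota 0 s] ++ [seq N%:Z + 1 + i%:Z | i <- iota 0 s].
have -> : (2 * s = size near)%N by rewrite size_cat !size_map size_iota; lia.
apply: uniq_leq_size => // p /h; rewrite /excursion => hp; rewrite mem_cat; apply/orP.
move: hp; case: ifP => p0.
  by left; apply/mapP; exists (absz p); rewrite ?mem_iota; lia.
case: ifP => // pN; right; apply/mapP; exists (absz (p - N%:Z - 1)%R);
  rewrite ?mem_iota; lia.
Qed.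

(** An active bond is one of the two active bonds of the block or touches a site
whose occupation has changed; there are twice as many of those as particles outside
the block. At most [2 * s] particles are outside at distance at most [s], and each of
the others has needed more than [s] steps. The statement is multiplied by [s] to stay
in the natural numbers. *)
Lemma size_active (s n : nat) X : walks n X != 0%N ->
  (s * size (active X) <= 2 * s + 4 * n + 8 * s ^ 2)%N.
Proof.
move=> /walks_excursion le; set Y := step_config N.
pose out := enum_fset (val X `\` val Y)%fset.
pose holes := enum_fset (val Y `\` val X)%fset.
have sz : size holes = size out.
  have swap_card (A B : {fset int}) : #|` A| = #|` B| -> #|` A `\` B|%fset =
    #|` B `\` A|%fset.
    by move=> AB; have := cardfsID A B; have := cardfsID B A; rewrite fsetIC; lia.
  by apply: swap_card; rewrite (eqP (valP X)) (eqP (valP (step_config N))).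
have act : (size (active X) <= 2 + 4 * size out)%N.
  pose r := [:: 0; N%:Z] ++ out ++ holes ++ [seq p - 1 | p <- out] ++ [seq p - 1 | p <-
    holes].
  have -> : (2 + 4 * size out = size r)%N.
    by rewrite !size_cat !size_map sz /=; lia.
  apply: uniq_leq_size => [|j]; first exact: active_uniq.
  rewrite mem_active !mem_cat => h.
  have mo p : (p \in out) = occ X p && ~~ occ Y p by rewrite inE andbC.
  have mh p : (p \in holes) = occ Y p && ~~ occ X p by rewrite inE andbC.
  have m1 r' : (j \in [seq p - 1 | p <- r']) = (j + 1 \in r').
    apply/mapP/idP => [ [p pr ->] | jr]; first by rewrite subrK.
    by exists (j + 1); rewrite ?addrK.
  rewrite !m1 !mo !mh.
  have : (occ Y j (+) occ Y (j + 1)) ==> (j \in [:: 0; N%:Z]).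
    by rewrite !occ_step !inE; apply/implyP; lia.
  move: h; case: (occ X j); case: (occ X (j + 1)); case: (occ Y j); case: (occ Y (j + 1));
  by rewrite /= ?orbT // => _ ->.
have uo : uniq out by exact: fset_uniq.
have near : (size [seq p <- out | (excursion p <= s)%N] <= 2 * s)%N.
  apply: card_near; first by rewrite filter_uniq.
  move=> p; rewrite mem_filter inE => /and3P[es pY pX]; rewrite es andbT.
  by move: pY; rewrite -[_ \in _]/(occ Y p) occ_step /excursion; do ! (case: ifP => ?); lia.
have far : (s * count (fun p => s < excursion p)%N out <= weight excursion X)%N.
  have po : perm_eq [seq p <- enum_fset (val X) | ~~ occ Y p] out.
    apply: uniq_perm => [||p]; rewrite ?filter_uniq ?fset_uniq //.
    by rewrite mem_filter inE.
  rewrite /weight (bigID (occ Y)) /= -[X in (_ + X)%N]big_filter (perm_big _ po) /=.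
  apply: leq_trans (leq_addl _ _); elim: (out) => [|p r IH]; first by rewrite muln0.
  by rewrite big_cons /= mulnDr leq_add //; case: ltnP => h; rewrite ?muln1 ?muln0 // ltnW.
have cnt : size out = (size [seq p <- out | (excursion p <= s)%N] + count (fun p =>
  s < excursion p)%N out)%N.
  rewrite size_filter -(count_predC (fun p => excursion p <= s)%N out); congr (_ + _)%N.
  by apply: eq_count => p /=; rewrite -ltnNge.
apply: (@leq_trans (s * (2 + 4 * size out))%N); first by rewrite leq_mul2l act orbT.
have : (s * size out <= n + 2 * s ^ 2)%N.
  rewrite cnt mulnDr addnC leq_add // ?(leq_trans far) //.
  by rewrite expnS expn1 mulnA [(2 * s)%N]mulnC -mulnA leq_mul2l near orbT.
by move: (size out) (s ^ 2)%N => a b; rewrite mulnDr; nia.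
Qed.

End Walks.

(** * A bound on the number of walks, uniform in the number of particles *)

Section WalkBound.
Variable R : realType.

(** Each walk of length [n] has as many continuations as its end has active bonds;
[hop_adjoint] exchanges the sums over starting and final configurations. *)
Lemma walks_l1_step N (s n : nat) :
  (s%:R%:E * overlap R setT (@walks N n.+1) (fun=> 1%N) <=
   (2 * s + 4 * n + 8 * s ^ 2)%N%:R%:E * overlap R setT (@walks N n) (fun=> 1%N))%E.
Proof.
pose B := bonds (- n%:Z) (N%:Z + 1 + n%:Z).
have uB : uniq B by exact: bonds_uniq.
have mB j : - n%:Z <= j < N%:Z + 1 + n%:Z -> j \in B by rewrite mem_bonds; lia.
have -> : overlap R setT (@walks N n.+1) (fun=> 1%N) =
   overlap R setT (@walks N n) (fun X =>
     hop false B (fun=> 1%N) X + hop true B (fun=> 1%N) X)%N.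
  transitivity (overlap R setT (hop true B (@walks N n)) (fun=> 1%N) +
                overlap R setT (hop false B (@walks N n)) (fun=> 1%N))%E.
    rewrite -esumD; [|by move=> *; rewrite lee_fin..].
    apply: eq_esum => X _; rewrite -EFinD -natrD; congr (_%:R%:E).
    by rewrite (walks_hop X uB mB) mulnDl.
  rewrite !hop_adjoint // -esumD; [|by move=> *; rewrite lee_fin..].
  by apply: eq_esum => X _; rewrite -EFinD -natrD mulnDr.
rewrite -!overlapZ; apply: le_esum => X _; rewrite lee_fin ler_nat.
have [->|nz] := eqVneq (walks n X) 0%N; first by rewrite !mul0n.
rewrite leq_mul2l muln1; apply/orP; right.
apply: leq_trans (size_active s nz); rewrite leq_mul2l; apply/orP; right.
rewrite /hop !(big_mkcond (fun j => edge _ j X)) -big_split /=.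
rewrite (eq_bigr (fun j => (j \in active X : nat))); last first.
  move=> j _; rewrite active_edge /edge.
  by case: (occ X j); case: (occ X (j + 1)).
rewrite sum_pred1 -size_filter; apply: uniq_leq_size; first by rewrite filter_uniq.
by move=> j; rewrite mem_filter => /andP[].
Qed.

Fixpoint walk_bound (s n : nat) : R :=
  if n is n'.+1 then walk_bound s n' * ((2 * s + 4 * n' + 8 * s ^ 2)%N%:R / s%:R)
  else 1.

Lemma walk_bound_ge0 s n : 0 <= walk_bound s n.
Proof. by elim: n => //= n IH; rewrite mulr_ge0 // divr_ge0. Qed.

Lemma walks_l1 N s n : (0 < s)%N ->
  (overlap R setT (@walks N n) (fun=> 1%N) <= (walk_bound s n)%:E)%E.
Proof.
move=> s0; elim: n => [|n IH] /=.
  rewrite /overlap (esumID [set step_config N]) //.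
  rewrite !setTI esum_set1 /origin ?lee_fin // eqxx esum1 ?adde0 //.
  by move=> X /eqP/negbTE ->.
have := walks_l1_step N s n => st.
have s0' : (0 < s%:R :> R) by rewrite ltr0n.
rewrite -(@lee_pmul2l _ s%:R%:E) ?lte_fin //.
apply: (le_trans st); rewrite -EFinM.
have -> : s%:R * (walk_bound s n * ((2 * s + 4 * n + 8 * s ^ 2)%:R / s%:R)) =
   (2 * s + 4 * n + 8 * s ^ 2)%N%:R * walk_bound s n.
  by field; rewrite gt_eqF.
by rewrite EFinM lee_pmul2l ?lte_fin ?ltr0n //; lia.
Qed.

Lemma walks_le N s n (X : config N) : (0 < s)%N ->
  (walks n X)%:R <= walk_bound s n.
Proof.
move=> s0; rewrite -lee_fin; apply: le_trans (walks_l1 N n s0).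
rewrite /overlap (esumID [set X]) // setTI esum_set1 ?lee_fin // muln1.
by rewrite leeDl // esum_ge0 // => Y _; rewrite lee_fin.
Qed.

Variable t : R.
Hypothesis t0 : 0 < t.

(** A bound, uniform in N, of the l^1 norm of the [k]-th term of the exponential
series. *)
Definition major (s k : nat) : R := t ^+ k / k`!%:R * walk_bound s k.

Lemma major_ge0 s k : 0 <= major s k.
Proof. by rewrite mulr_ge0 ?walk_bound_ge0 // divr_ge0 // exprn_ge0 // ltW. Qed.

(** While the ratio of consecutive terms is at most 1/2, the partial sum plus twice
the next term does not increase. *)
Lemma ratio_summable (u : R^nat) (n0 : nat) :
  (forall n, 0 <= u n) -> (forall n, (n0 <= n)%N -> u n.+1 <= u n / 2) ->
  exists M, forall n, \sum_(0 <= k < n) u k <= M.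
Proof.
move=> u0 h.
have mono n m : (n <= m)%N -> \sum_(0 <= k < n) u k <= \sum_(0 <= k < m) u k.
  move=> nm; rewrite (big_cat_nat (leq0n n) nm) //= lerDl.
  by rewrite sumr_ge0.
have step d : \sum_(0 <= k < n0 + d) u k + 2 * u (n0 + d)%N <= \sum_(0 <=
  k < n0) u k + 2 * u n0.
  elim: d => [|d IH]; first by rewrite addn0.
  apply: le_trans IH; rewrite addnS big_nat_recr //= -addrA lerD2l.
  by have := h (n0 + d)%N (leq_addr _ _); have := u0 (n0 + d)%N; lra.
exists (\sum_(0 <= k < n0) u k + 2 * u n0) => n.
apply: le_trans (mono n (n0 + n)%N (leq_addl _ _)) _.
by apply: le_trans (step n); rewrite lerDl mulr_ge0.
Qed.

(** The ratio of consecutive terms is [t (2 s + 4 n + 8 s^2) / (s (n + 1))], which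
tends to [4 t / s]; so [s] is taken larger than [16 t] to have it below 1/2 in the end. *)
Lemma major_summable : exists s M, (0 < s)%N /\
  forall n, \sum_(0 <= k < n) major s k <= M.
Proof.
pose s := (Num.bound (16 * t)).+1.
have s16 : 16 * t <= s%:R.
  have /ltW := archi_boundP (ltW (mulr_gt0 (ltr0Sn R 15) t0)).
  by move/le_trans; apply; rewrite ler_nat.
pose n0 := Num.bound (4 * t * (2 + 8 * s%:R)).
have hn0 : 4 * t * (2 + 8 * s%:R) <= n0%:R.
  by apply/ltW/archi_boundP; rewrite !mulr_ge0 ?addr_ge0 // ?mulr_ge0 // ltW.
suff ratio n : (n0 <= n)%N -> major s n.+1 <= major s n / 2.
  by have [M hM] := ratio_summable (major_ge0 s) ratio; exists s, M.
move=> nn0; rewrite /major /=.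
have -> : t ^+ n.+1 / (n.+1)`!%:R * (walk_bound s n * ((2 * s + 4 * n + 8 * s ^ 2)%:R /
  s%:R)) =
  (t ^+ n / n`!%:R * walk_bound s n) * (t * (2 * s + 4 * n + 8 * s ^ 2)%:R / (s%:R *
    n.+1%:R)).
  rewrite factS natrM exprS; field.
  by rewrite addrC natr1 !pnatr_eq0 -!lt0n ?fact_gt0.
apply: ler_wpM2l; first exact: major_ge0.
have sp : 0 < s%:R :> R by rewrite ltr0n.
have np : 0 < n.+1%:R :> R by rewrite ltr0n.
rewrite ler_pdivrMr ?mulr_gt0 //.
have n0n : n0%:R <= n%:R :> R by rewrite ler_nat.
have e1 : 16 * t * n%:R <= s%:R * n%:R by apply: ler_wpM2r.
have e2 : (4 * t * (2 + 8 * s%:R)) * s%:R <= n%:R * s%:R by apply: ler_wpM2r;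
  [exact: ltW|exact: le_trans n0n].
rewrite (natrD _ (2 * s + 4 * n) (8 * s ^ 2)) (natrD _ (2 * s) (4 * n)) (natrM _ 2 s)
  (natrM _ 4 n) (natrM _ 8 (s ^ 2)) natrX -[n.+1%:R]natr1.
move: (n%:R : R) (s%:R : R) sp s16 n0n e1 e2 => n' s' sp s16 n0n e1 e2.
nra.
Qed.

End WalkBound.

(** * Tails of dominated series, and their sums over a set *)

Section Tails.
Variables (R : realType).
Implicit Types (a u : R^nat).

Definition tail a (n : nat) : \bar R := (\sum_(n <= k <oo) (a k)%:E)%E.

Lemma tail_ge0 a n : (forall k, 0 <= a k) -> (0 <= tail a n)%E.
Proof. by move=> a0; apply: nneseries_ge0 => k _ _; rewrite lee_fin. Qed.

Lemma tail_le a n M : (forall k, 0 <= a k) ->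
  (forall n, \sum_(0 <= k < n) a k <= M) -> (tail a n <= M%:E)%E.
Proof.
move=> a0 aM; apply: lime_le; first by apply: is_cvg_nneseries => k _ _; rewrite lee_fin.
apply: nearW => p; rewrite sumEFin lee_fin.
have [np|pn] := leqP n p; last first.
  rewrite big_geq; first by apply: le_trans (aM 0%N); rewrite big_geq.
  exact: ltnW.
by apply: le_trans (aM p); rewrite [leRHS](big_cat_nat (leq0n n) np) /= lerDr sumr_ge0.
Qed.

Lemma tail_fin a n M : (forall k, 0 <= a k) ->
  (forall n, \sum_(0 <= k < n) a k <= M) -> tail a n \is a fin_num.
Proof.
move=> a0 aM; rewrite ge0_fin_numE ?tail_ge0 //.
by apply: le_lt_trans (tail_le n a0 aM) _; rewrite ltry.
Qed.

Lemma tail_cvg a M : (forall k, 0 <= a k) ->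
  (forall n, \sum_(0 <= k < n) a k <= M) -> tail a n @[n --> \oo] --> 0%E.
Proof.
move=> a0 aM; apply: (@nneseries_tail_cvg _ (fun k => (a k)%:E) xpredT).
  by apply: le_lt_trans (tail_le 0 a0 aM) _; rewrite ltry.
by move=> k _; rewrite lee_fin.
Qed.

Lemma partial_tail a n p : (forall k, 0 <= a k) ->
  ((\sum_(n <= k < p) a k)%:E <= tail a n)%E.
Proof.
move=> a0; rewrite -sumEFin; apply: nneseries_lim_ge => k _ _.
by rewrite lee_fin.
Qed.

Lemma dominated_series a u M : (forall k, `|u k| <= a k) ->
  (forall n, \sum_(0 <= k < n) a k <= M) ->
  exists l : R, [/\ series u @ \oo --> l, `|l| <= M &
    forall n, ((`|\sum_(0 <= k < n) u k - l|)%:E <= tail a n)%E].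
Proof.
move=> ua aM; have a0 k : 0 <= a k by apply: le_trans (ua k).
have cu : cvgn (series u).
  apply: normed_cvg; apply: nondecreasing_is_cvgn.
    by apply: (@nondecreasing_series _ (fun k => `|u k|) xpredT).
  exists M => _ [n _ <-]; apply: le_trans (aM n).
  by rewrite /series /=; apply: ler_sum.
exists (limn (series u)); split => //.
  have b n : `|series u n| <= M.
    apply: le_trans (aM n); apply: le_trans (ler_norm_sum _ _ _) _.
    exact: ler_sum.
  rewrite ler_norml; apply/andP; split.
    by apply: limr_ge => //; apply: nearW => n; have := b n; rewrite ler_norml => /andP[].
  by apply: limr_le => //; apply: nearW => n; have := b n; rewrite ler_norml => /andP[].
move=> n; have fin := tail_fin n a0 aM.
rewrite -(fineK fin) lee_fin; set r := fine _.
have near p : (n <= p)%N -> `|\sum_(0 <= k < n) u k - series u p| <= r.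
  move=> np; rewrite /series /= [\sum_(0 <= k < p) u k](big_cat_nat (leq0n n) np) /=.
  rewrite opprD addrA subrr add0r normrN -lee_fin fineK //.
  apply: le_trans (partial_tail n p a0); rewrite lee_fin.
  by apply: le_trans (ler_norm_sum _ _ _) _; apply: ler_sum.
rewrite ler_norml; apply/andP; split.
  rewrite lerBrDl -lerBrDr opprK; apply: limr_le => //.
  exists n => // p /= np; have := near p np; rewrite ler_norml => /andP[+ _]; lra.
rewrite lerBlDl -lerBlDr; apply: limr_ge => //.
exists n => // p /= np; have := near p np; rewrite ler_norml => /andP[_]; lra.
Qed.

(** Exchange of two sums of nonnegative terms. *)
Lemma esum_tail (T : choiceType) (a : nat -> T -> R) (b : R^nat) n :
  (forall k X, 0 <= a k X) ->
  (forall k, (\esum_(X in [set: T]) (a k X)%:E <= (b k)%:E)%E) ->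
  (\esum_(X in [set: T]) tail (a^~ X) n <= tail b n)%E.
Proof.
move=> a0 ab.
have E X : tail (a^~ X) n = (\esum_(k in [set k | (n <= k)%N]) (a k X)%:E)%E.
  rewrite /tail ereal_series nneseries_esum // => k _; rewrite lee_fin //.
under eq_esum do rewrite E.
rewrite esum_esum; last by move=> X k _ _; rewrite lee_fin.
rewrite (reindex_esum ([set k | (n <= k)%N] `*`` (fun=> [set: T])) _ (fun x => (x.2,
  x.1))) /=; last first.
  split.
  - by move=> [k X] /= [].
  - by move=> [k X] [k' X'] /= _ _ [-> ->].
  - by move=> [X k] /= [_ nk]; exists (k, X).
rewrite -(esum_esum (a := fun k X => (a k X)%:E)); last by move=> X k _ _; rewrite lee_fin.
rewrite -nneseries_esum -?ereal_series; last first.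
  by move=> k _; apply: esum_ge0 => X _; rewrite lee_fin.
rewrite /tail [leRHS]ereal_series ereal_series.
apply: lee_nneseries => k *; last exact: ab.
by apply: esum_ge0 => X _; rewrite lee_fin.
Qed.

End Tails.

(** * The evolution as a pointwise series *)

Section Evolution.
Variables (R : realType) (t : R).
Hypothesis t0 : 0 < t.
Local Notation normc := ComplexField.Normc.normc.
Local Notation Re := complex.Re.
Local Notation Im := complex.Im.

Lemma ReD (y z : R[i]) : Re (y + z) = Re y + Re z.
Proof. by case: y => a b; case: z. Qed.

Lemma ImD (y z : R[i]) : Im (y + z) = Im y + Im z.
Proof. by case: y => a b; case: z. Qed.

Lemma ReN (y : R[i]) : Re (- y) = - Re y.
Proof. by case: y. Qed.

Lemma ImN (y : R[i]) : Im (- y) = - Im y.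
Proof. by case: y. Qed.

Lemma Re_scale (z : R[i]) (r : R) : Re (z * (r%:C)%C) = Re z * r.
Proof. by case: z => a b /=; rewrite mulr0 subr0. Qed.

Lemma Im_scale (z : R[i]) (r : R) : Im (z * (r%:C)%C) = Im z * r.
Proof. by case: z => a b /=; rewrite mulr0 add0r. Qed.

Lemma normc_sqr (z : R[i]) : normc z ^+ 2 = Re z ^+ 2 + Im z ^+ 2.
Proof. by case: z => a b /=; rewrite sqr_sqrtr // addr_ge0 // sqr_ge0. Qed.

Lemma normc_nneg (z : R[i]) : 0 <= normc z.
Proof. by case: z => a b; exact: sqrtr_ge0. Qed.

Definition phase (k : nat) : R[i] := (- 'i%C) ^+ k.

Lemma phaseS k : Re (phase k.+1) = Im (phase k) /\ Im (phase k.+1) = - Re (phase k).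
Proof.
rewrite /phase exprS; case: (_ ^+ k) => a b /=.
by split; ring.
Qed.

Lemma phase_unit k : Re (phase k) ^+ 2 + Im (phase k) ^+ 2 = 1.
Proof.
elim: k => [|k IH]; first by rewrite /phase expr0 /=; ring.
by have [-> ->] := phaseS k; rewrite sqrrN addrC.
Qed.

Lemma phase_le1 k : `|Re (phase k)| <= 1 /\ `|Im (phase k)| <= 1.
Proof.
have := phase_unit k; move: (Re _) (Im _) => a b ab.
split; rewrite -(@ler_pXn2r _ 2) ?nnegrE // expr1n real_normK ?num_real //.
  by rewrite -ab lerDl sqr_ge0.
by rewrite -ab lerDr sqr_ge0.
Qed.

Lemma esumZl_le (T : choiceType) (S : set T) (a : T -> \bar R) (c : R) :
  0 <= c -> (forall X, S X -> 0 <= a X)%E ->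
  (\esum_(X in S) (c%:E * a X) <= c%:E * \esum_(X in S) a X)%E.
Proof.
move=> c0 a0; apply: ge_ereal_sup => _ [F [finF FS] <-].
rewrite fsbig_finite //= big_seq -ge0_sume_distrr; last first.
  by move=> X; rewrite in_fset_set // inE => /FS/a0.
apply: lee_wpmul2l; rewrite ?lee_fin // -big_seq -fsbig_finite //.
by apply: ereal_sup_ubound; exists F.
Qed.

Lemma esumZl (T : choiceType) (S : set T) (a : T -> \bar R) (c : R) :
  0 <= c -> (forall y, S y -> 0 <= a y)%E ->
  (\esum_(y in S) (c%:E * a y) = c%:E * \esum_(y in S) a y)%E.
Proof.
move=> c0 a0; apply/eqP; rewrite eq_le esumZl_le //=.
have [->|nz] := eqVneq c 0; first by rewrite mul0e esum_ge0 // => X _; rewrite mul0e.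
have cp : 0 < c by rewrite lt_neqAle eq_sym nz.
rewrite -lee_pdivlMl //; apply: le_trans (esumZl_le _ _).
- by apply: le_esum => y Sy; rewrite muleA -EFinM mulVf // mul1e.
- by rewrite invr_ge0.
- by move=> y Sy; rewrite mule_ge0 // ?a0.
Qed.

(** The [k]-th term of the exponential series at [X], without its phase. *)
Definition amp N (k : nat) (X : config N) : R := t ^+ k / k`!%:R * (walks k X)%:R.

Lemma amp_ge0 N k (X : config N) : 0 <= amp k X.
Proof. by rewrite mulr_ge0 // divr_ge0 // exprn_ge0 // ltW. Qed.

Lemma exp_partialE N n (X : config N) :
  exp_partial 0 t (Defs.basis (step_config N)) n X =
  \sum_(0 <= k < n) phase k * ((amp k X)%:C)%C.
Proof.
apply: eq_bigr => k _; rewrite walksE exprMn /phase /amp -!mulrA; congr (_ * _).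
by rewrite !rmorphM /= rmorphXn /= fmorphV /= !rmorph_nat.
Qed.

Lemma Re_exp_partial N n (X : config N) :
  Re (exp_partial 0 t (Defs.basis (step_config N)) n X) =
  \sum_(0 <= k < n) Re (phase k) * amp k X.
Proof.
rewrite exp_partialE (big_morph _ ReD (erefl : Re 0 = 0)).
by apply: eq_bigr => k _; rewrite Re_scale.
Qed.

Lemma Im_exp_partial N n (X : config N) :
  Im (exp_partial 0 t (Defs.basis (step_config N)) n X) =
  \sum_(0 <= k < n) Im (phase k) * amp k X.
Proof.
rewrite exp_partialE (big_morph _ ImD (erefl : Im 0 = 0)).
by apply: eq_bigr => k _; rewrite Im_scale.
Qed.

Variables (s : nat) (M : R).
Hypotheses (s0 : (0 < s)%N)
  (sM : forall n, \sum_(0 <= k < n) major t s k <= M).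

Lemma amp_major N k (X : config N) : amp k X <= major t s k.
Proof.
apply: ler_wpM2l; last exact: walks_le.
by rewrite divr_ge0 // exprn_ge0 // ltW.
Qed.

Lemma amp_sum N n (X : config N) : \sum_(0 <= k < n) amp k X <= M.
Proof. by apply: le_trans (sM n); apply: ler_sum => k _; exact: amp_major. Qed.

Lemma M_ge0 : 0 <= M.
Proof. by have := sM 0; rewrite big_geq. Qed.

Lemma amp_tail_sum N n :
  (\esum_(X in [set: config N]) tail (@amp N ^~ X) n <= tail (major t s) n)%E.
Proof.
apply: esum_tail => [k X|k]; first exact: amp_ge0.
have c0 : 0 <= t ^+ k / k`!%:R by rewrite divr_ge0 // exprn_ge0 // ltW.
rewrite /amp /major EFinM; under eq_esum do rewrite EFinM.
apply: le_trans (esumZl_le c0 _) _; first by move=> X _; rewrite lee_fin.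
apply: lee_wpmul2l; first by rewrite lee_fin.
apply: le_trans (walks_l1 R N k s0).
by apply: le_esum => X _; rewrite muln1.
Qed.

Definition evo N : config N -> R[i] := evolution 0 t (Defs.basis (step_config N)).
Definition evo_trunc N n : config N -> R[i] :=
  exp_partial 0 t (Defs.basis (step_config N)) n.

(** A value for the sum of the series at [X], with the error of every truncation. *)
Definition near_trunc N (X : config N) (z : R[i]) : Prop :=
  [/\ `|Re z| <= M, `|Im z| <= M &
   forall n, ((`|Re (evo_trunc n X - z)|)%:E <= tail (@amp N ^~ X) n)%E /\
             ((`|Im (evo_trunc n X - z)|)%:E <= tail (@amp N ^~ X) n)%E].

Lemma near_trunc_exists N (X : config N) : exists z, near_trunc X z.
Proof.
have a0 k := amp_ge0 k X.
have [k|l [_ lM lT]] := @dominated_series R (@amp N ^~ X)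
    (fun k => Re (phase k) * amp k X) M _ (fun n => amp_sum n X).
  by rewrite normrM (ger0_norm (amp_ge0 k X)) ler_piMl //; have [] := phase_le1 k.
have [k|l' [_ lM' lT']] := @dominated_series R (@amp N ^~ X)
    (fun k => Im (phase k) * amp k X) M _ (fun n => amp_sum n X).
  by rewrite normrM (ger0_norm (amp_ge0 k X)) ler_piMl //; have [] := phase_le1 k.
exists (l +i* l')%C; split => // n; split.
  by rewrite ReD ReN Re_exp_partial; exact: lT.
by rewrite ImD ImN Im_exp_partial; exact: lT'.
Qed.

Lemma near_trunc_normc N (X : config N) z n : near_trunc X z ->
  (((normc (evo_trunc n X - z)) ^+ 2)%:E <= (2 * M)%:E * tail (@amp N ^~ X) n)%E.
Proof.
move=> [_ _ /(_ n)[h1 h2]]; have a0 k := amp_ge0 k X.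
have fin := tail_fin n a0 (fun n => amp_sum n X).
have rM := tail_le n a0 (fun n => amp_sum n X).
move: h1 h2 rM; rewrite -(fineK fin) !lee_fin => h1 h2 rM.
rewrite normc_sqr -(real_normK (num_real (Re _))) -(real_normK (num_real (Im _))).
move: (normr_ge0 (Re (evo_trunc n X - z))) (normr_ge0 (Im (evo_trunc n X - z))).
move: (`|Re _|) (`|Im _|) (fine _) h1 h2 rM => a b r; nra.
Qed.

Lemma near_small (c : nat -> \bar R) (e : R) : c @ \oo --> 0%E -> 0 < e ->
  \forall n \near \oo, (c n < e%:E)%E.
Proof. by move=> c0 e0; apply: (c0 (fun u => (u < e%:E)%E)); apply: open_ereal_lt';
  rewrite lte_fin. Qed.

Lemma major_tail_cvg : tail (major t s) n @[n --> \oo] --> 0%E.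
Proof. by apply: tail_cvg sM => k; exact: major_ge0. Qed.

(** The pointwise sums of the series form an l^2 limit of the partial sums, because
the squared error is at most a constant times the tail, whose sum over [X] is
controlled by [amp_tail_sum]. And l^2 limits are determined pointwise, so that the
limit chosen in the definition of [evolution] is this one. *)
Lemma evo_near N (X : config N) : near_trunc X (evo X).
Proof.
have [psi psiP] := choice (@near_trunc_exists N).
have a0 (Z : config N) k := amp_ge0 k Z.
pose S : set (config N -> R[i]) := [set g |
  l2_normsq (fun X => evo_trunc n X - g X) @[n --> \oo] --> 0%E].
have Spsi : S psi.
  apply: (@squeeze_cvge _ _ _ _ (fun=> 0%E) _ (fun n => (2 * M)%:E * tail (major t s) n)%E).
  - apply: nearW => n; apply/andP; split.
      by apply: esum_ge0 => Z _; rewrite lee_fin sqr_ge0.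
    apply: (@le_trans _ _ (\esum_(Z in [set: config N]) ((2 * M)%:E * tail (@amp N ^~
      Z) n))%E).
      by apply: le_esum => Z _; apply: near_trunc_normc.
    apply: le_trans (esumZl_le _ _) _; first by rewrite mulr_ge0 // M_ge0.
      by move=> Z _; apply: tail_ge0.
    by apply: lee_wpmul2l; [rewrite lee_fin mulr_ge0 // M_ge0|exact: amp_tail_sum].
  - exact: cvg_cst.
  - by rewrite -[X in _ --> X](mule0 (2 * M)%:E); apply: cvgeZl => //;
    exact: major_tail_cvg.
have Sevo : S (@evo N) by apply: (@xgetPex _ _ S); exists psi.
suff -> : evo X = psi X by exact: psiP.
have coord n : (`|Re (evo X) - Re (psi X)|%:E <=
  tail (@amp N ^~ X) n + (normc (evo_trunc n X - evo X))%:E)%E /\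
  (`|Im (evo X) - Im (psi X)|%:E <=
    tail (@amp N ^~ X) n + (normc (evo_trunc n X - evo X))%:E)%E.
  have [_ _ /(_ n)[h1 h2]] := psiP X.
  have nRI (z : R[i]) : `|Re z| <= normc z /\ `|Im z| <= normc z.
    have n0 := normc_nneg z.
    split; rewrite -(@ler_pXn2r _ 2) ?nnegrE // real_normK ?num_real // normc_sqr.
      by rewrite lerDl sqr_ge0.
    by rewrite lerDr sqr_ge0.
  have [n1 n2] := nRI (evo_trunc n X - evo X).
  have fin := tail_fin n (a0 X) (fun n => amp_sum n X).
  move: h1 h2; rewrite -(fineK fin) !lee_fin => h1 h2.
  rewrite !ReD !ReN !ImD !ImN in n1 n2 h1 h2.
  split.
    have -> : Re (evo X) - Re (psi X) =
      (Re (evo_trunc n X) - Re (psi X)) - (Re (evo_trunc n X) - Re (evo X)) by ring.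
    by apply: le_trans (ler_normB _ _) _; apply: lerD.
  have -> : Im (evo X) - Im (psi X) =
    (Im (evo_trunc n X) - Im (psi X)) - (Im (evo_trunc n X) - Im (evo X)) by ring.
  by apply: le_trans (ler_normB _ _) _; apply: lerD.
have small e : 0 < e -> `|Re (evo X) - Re (psi X)| < e /\ `|Im (evo X) - Im (psi X)| < e.
  move=> e0; have e2 : 0 < e / 2 by rewrite divr_gt0.
  have f1 := near_small (tail_cvg (a0 X) (fun n => amp_sum n X)) e2.
  have f2 : \forall n \near \oo, (l2_normsq (fun Y : config N =>
    evo_trunc n Y - evo Y)%R < ((e / 2) ^+ 2)%:E)%E.
    by apply: near_small Sevo _; exact: exprn_gt0.
  near \oo => n.
  have g1 : (tail (@amp N ^~ X) n < (e / 2)%:E)%E by near: n.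
  have g2 : (l2_normsq (fun Y : config N =>
    evo_trunc n Y - evo Y)%R < ((e / 2) ^+ 2)%:E)%E by near: n.
  have g3 : normc (evo_trunc n X - evo X) < e / 2.
    rewrite -(@ltr_pXn2r _ 2) ?nnegrE ?normc_nneg ?(ltW e2) //.
    rewrite -lte_fin; apply: le_lt_trans g2.
    rewrite /l2_normsq (esumID [set X]); last by move=> Y _; rewrite lee_fin sqr_ge0.
    rewrite setTI esum_set1 ?lee_fin ?sqr_ge0 //.
    by rewrite leeDl // esum_ge0 // => Y _; rewrite lee_fin sqr_ge0.
  have [c1 c2] := coord n.
  have sum_lt : (tail (@amp N ^~ X) n + (normc (evo_trunc n X - evo X))%:E < e%:E)%E.
    rewrite (splitr e) EFinD lteD //.
  by rewrite -!lte_fin; split; [exact: le_lt_trans c1 _|exact: le_lt_trans c2 _].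
have eq0 a : (forall e, 0 < e -> `|a| < e) -> a = 0 :> R.
  move=> h; apply/eqP; rewrite -normr_le0 leNgt; apply/negP => /h; by rewrite ltxx.
apply/eqP; rewrite eq_complex; apply/andP; split; rewrite -subr_eq0; apply/eqP/eq0 =>
  e /small[] //.
Unshelve. all: by end_near.
Qed.

End Evolution.

(** * Truncation of the series *)

Section Truncation.
Variables (R : realType) (t : R) (s : nat) (M : R).
Hypotheses (t0 : 0 < t) (s0 : (0 < s)%N)
  (sM : forall n, \sum_(0 <= k < n) major t s k <= M).
Local Notation normc := ComplexField.Normc.normc.
Local Notation Re := complex.Re.
Local Notation Im := complex.Im.

Definition prob_part N n (S : set (config N)) : \bar R :=
  (\esum_(X in S) ((normc (evo_trunc t n X)) ^+ 2)%:E)%E.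

Lemma sqr_close (a b r : R) : `|a| <= M -> `|b| <= M -> `|b - a| <= r ->
  a ^+ 2 <= b ^+ 2 + 2 * M * r /\ b ^+ 2 <= a ^+ 2 + 2 * M * r.
Proof.
rewrite !ler_norml => /andP[a1 a2] /andP[b1 b2] /andP[c1 c2].
have M0 : 0 <= M by lra.
have r0 : 0 <= r by lra.
have h : `|b ^+ 2 - a ^+ 2| <= 2 * M * r.
  have -> : b ^+ 2 - a ^+ 2 = (b + a) * (b - a) by ring.
  by rewrite normrM; apply: ler_pM => //; rewrite ler_norml; lra.
by move: h; rewrite ler_norml => /andP[]; lra.
Qed.

(** Squared moduli of numbers bounded by [M] differ by at most a constant times the
distance of these numbers, and the sum of the distances is at most the l^1 tail. *)
Lemma prob_truncate N n (S : set (config N)) :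
  let P := (\esum_(X in S) ((normc (evo t X)) ^+ 2)%:E)%E in
  (P <= prob_part n S + (4 * M)%:E * tail (major t s) n)%E /\
  (prob_part n S <= P + (4 * M)%:E * tail (major t s) n)%E.
Proof.
have M0 := M_ge0 sM.
have pt (X : config N) :
   (((normc (evo t X)) ^+ 2)%:E <= ((normc (evo_trunc t n X)) ^+ 2)%:E + (4 * M)%:E *
     tail (@amp R t N ^~ X) n)%E /\
   (((normc (evo_trunc t n X)) ^+ 2)%:E <=
     ((normc (evo t X)) ^+ 2)%:E + (4 * M)%:E * tail (@amp R t N ^~ X) n)%E.
  have [rM iM /(_ n)[h1 h2]] := evo_near t0 s0 sM X.
  have a0 k := amp_ge0 t0 k X.
  have fin := tail_fin n a0 (fun n => amp_sum t0 s0 sM n X).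
  move: h1 h2; rewrite -(fineK fin) !lee_fin => h1 h2; rewrite !normc_sqr.
  rewrite ReD ReN in h1; rewrite ImD ImN in h2.
  have rb : `|Re (evo_trunc t n X)| <= M.
    rewrite Re_exp_partial; apply: le_trans (ler_norm_sum _ _ _) _.
    apply: le_trans (amp_sum t0 s0 sM n X); apply: ler_sum => k _.
    by rewrite normrM (ger0_norm (a0 k)) ler_piMl //; have [] := phase_le1 R k.
  have ib : `|Im (evo_trunc t n X)| <= M.
    rewrite Im_exp_partial; apply: le_trans (ler_norm_sum _ _ _) _.
    apply: le_trans (amp_sum t0 s0 sM n X); apply: ler_sum => k _.
    by rewrite normrM (ger0_norm (a0 k)) ler_piMl //; have [] := phase_le1 R k.
  have [c1 c2] := sqr_close rM rb h1; have [c3 c4] := sqr_close iM ib h2.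
  split; [move: c1 c3|move: c2 c4]; move: (fine _) => r; lra.
have sum_tail : (\esum_(X in S) ((4 * M)%:E * tail (@amp R t N ^~ X) n) <=
  (4 * M)%:E * tail (major t s) n)%E.
  apply: le_trans (esumZl_le _ _) _; first by rewrite mulr_ge0.
    by move=> X _; apply: tail_ge0 => k; exact: amp_ge0.
  apply: lee_wpmul2l; first by rewrite lee_fin mulr_ge0.
  apply: le_trans (amp_tail_sum t0 s0 N n).
  rewrite esum_mkcond; apply: le_esum => X _; case: ifP => // _.
  by apply: tail_ge0 => k; exact: amp_ge0.
have nn (X : config N) : (0 <= (4 * M)%:E * tail (@amp R t N ^~ X) n)%E.
  by rewrite mule_ge0 ?lee_fin ?mulr_ge0 // tail_ge0 // => k; exact: amp_ge0.
split.
  apply: le_trans (leeD2l _ sum_tail); rewrite -esumD //; last by move=> X _;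
    rewrite lee_fin sqr_ge0.
  by apply: le_esum => X _; have [] := pt X.
apply: le_trans (leeD2l _ sum_tail); rewrite -esumD //; last by move=> X _;
  rewrite lee_fin sqr_ge0.
by apply: le_esum => X _; have [] := pt X.
Qed.

End Truncation.

(** * Powers of the Hamiltonian in terms of the two ladders *)

Section Amplitudes.
Variables (R : realType) (N K : nat) (m : int).
Hypotheses (Km : K%:Z < m) (mKN : m + K%:Z <= N%:Z).
Implicit Types X : config N.
Let K0 : 0 <= K%:Z. Proof. by []. Qed.
Local Notation BL := (left_bonds m K%:Z).
Local Notation BR := (right_bonds N m K%:Z).

(** The normalization for which raising operators multiply by the new index and
lowering operators have coefficient one. *)
Definition gspread (a b : nat) X : R := (spread m K%:Z a b X)%:R / (a`! * b`!)%:R.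

Lemma hop_scale c B (f : config N -> nat) (r : R) X :
  hop c B (fun Z => (f Z)%:R / r) X = (hop c B f X)%:R / r.
Proof. by rewrite /hop -mulr_suml natr_sum. Qed.

Lemma raise_left a b X : hop true BL (gspread a b) X = a.+1%:R * gspread a.+1 b X.
Proof.
rewrite hop_scale /gspread factS !natrM.
have -> : hop true BL (spread m K%:Z a b) X = spread m K%:Z a.+1 b X by [].
by field; rewrite addrC natr1 !pnatr_eq0 -!lt0n !fact_gt0.
Qed.

Lemma raise_right a b X : hop false BR (gspread a b) X = b.+1%:R * gspread a b.+1 X.
Proof.
rewrite hop_scale /gspread factS !natrM.
have -> : hop false BR (spread m K%:Z a b) X = spread m K%:Z a b.+1 X.
  by rewrite spreadC // iterS; apply: hop_ext => Z; rewrite spreadC.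
by field; rewrite addrC natr1 !pnatr_eq0 -!lt0n !fact_gt0.
Qed.

Lemma lower_left a b X : (a <= K)%N -> (b <= K)%N ->
  hop false BL (gspread a b) X = if a is a'.+1 then gspread a' b X else 0.
Proof.
move=> aK bK; rewrite hop_scale left_lower //; case: a aK => [|a] aK;
  first by rewrite mul0r.
rewrite /gspread factS !natrM.
by field; rewrite addrC natr1 !pnatr_eq0 -!lt0n !fact_gt0.
Qed.

Lemma lower_right a b X : (a <= K)%N -> (b <= K)%N ->
  hop true BR (gspread a b) X = if b is b'.+1 then gspread a b' X else 0.
Proof.
move=> aK bK; rewrite hop_scale right_lower //; case: b bK => [|b] bK;
  first by rewrite mul0r.
rewrite /gspread factS !natrM.
by field; rewrite addrC natr1 !pnatr_eq0 -!lt0n !fact_gt0.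
Qed.

(** [U^n e_Y / n!] for the sum [U] of the two raising operators. *)
Definition layer (n : nat) X : R := \sum_(a < n.+1) gspread a (n - a) X.

Lemma hop_sum (I : Type) (r : seq I) (P : pred I) c B (F : I -> config N -> R) X :
  hop c B (fun Z => \sum_(i <- r | P i) F i Z) X = \sum_(i <- r | P i) hop c B (F i) X.
Proof. by rewrite /hop exchange_big. Qed.

Lemma hopZ c B (f : config N -> R) (r : R) X :
  hop c B (fun Z => f Z * r) X = hop c B f X * r.
Proof. by rewrite /hop -mulr_suml. Qed.

Definition full_hop (f : config N -> R) X : R :=
  (hop true BL f X + hop false BR f X) + (hop false BL f X + hop true BR f X).

(** Both ends contribute to the commutator: hence the factor 2. *)
Lemma full_hop_layer n X : (n <= K)%N ->
  full_hop (layer n) X = n.+1%:R * layer n.+1 X + (if n is n'.+1 then 2 * layer n' X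
    else 0).
Proof.
move=> nK; rewrite /full_hop /layer !hop_sum; congr (_ + _).
  under eq_bigr do rewrite raise_left.
  under [X in _ + X]eq_bigr do rewrite raise_right.
  rewrite mulr_sumr.
  have E (a : nat) : (a <= n.+1)%N -> n.+1%:R * gspread a (n.+1 - a) X =
     a%:R * gspread a (n.+1 - a) X + (n.+1 - a)%:R * gspread a (n.+1 - a) X.
    by move=> an; rewrite -mulrDl -natrD subnKC.
  rewrite [RHS](eq_bigr (fun a : 'I_n.+2 =>
    a%:R * gspread a (n.+1 - a) X + (n.+1 - a)%:R * gspread a (n.+1 - a) X)); last first.
    by move=> a _; rewrite E // -ltnS.
  rewrite big_split /=; congr (_ + _).
    by rewrite [RHS]big_ord_recl mul0r add0r.
  rewrite [RHS]big_ord_recr /= subnn mul0r addr0; apply: eq_bigr => a _.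
  by rewrite subSn // -ltnS.
under eq_bigr => a _ do rewrite lower_left ?(leq_trans (leq_ord a)) ?(leq_trans
  (leq_subr _ _)) //.
under [X in _ + X]eq_bigr => a _ do rewrite lower_right ?(leq_trans (leq_ord a))
  ?(leq_trans (leq_subr _ _)) //.
case: n nK => [|n] nK; first by rewrite !big_ord1 addr0.
rewrite [X in X + _]big_ord_recl [X in _ + X]big_ord_recr /= subnn addr0 add0r
  mulr_natl mulr2n.
congr (_ + _); apply: eq_bigr => a _.
by rewrite subSn // -ltnS.
Qed.

Lemma walks_full_hop k X : (k <= K)%N ->
  (walks k.+1 X)%:R = full_hop (fun Z => (walks k Z)%:R) X :> R.
Proof.
move=> kK.
have hopR c B (f : config N -> nat) : hop c B (fun Z => (f Z)%:R) X = (hop c B f X)%:R :> R.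
  by rewrite /hop natr_sum.
rewrite /full_hop !hopR -!natrD; congr (_%:R).
rewrite (@walks_hop N k X (BL ++ BR)).
- have hc c : hop c (BL ++ BR) (walks k) X =
  (hop c BL (walks k) X + hop c BR (walks k) X)%N.
    by rewrite /hop big_cat.
  by rewrite !hc; lia.
- rewrite cat_uniq !bonds_uniq andbT /= -all_predC; apply/allP => j.
  rewrite (mem_right Km mKN K0) /= (mem_left Km mKN K0); lia.
- by move=> j hj; rewrite mem_cat (mem_left Km mKN K0) (mem_right Km mKN K0); lia.
Qed.

(** The [i]-th term of the coefficient of [s^k] in [e^{s^2} e^{s U} e_Y]. *)
Definition layer_term (k i : nat) X : R :=
  if (i.*2 <= k)%N then layer (k - i.*2) X / i`!%:R else 0.

(** The coefficient of [s^k] in [e^{s (U + D)} e_Y = e^{s^2} e^{s U} e_Y], by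
induction from [(k + 1) v_(k+1) = (U + D) v_k]: the factor [k + 1] is the sum of
[k + 1 - 2 i], which comes from [U], and of [2 i], which comes from [D]. *)
Lemma walks_layers k X : (k <= K.+1)%N ->
  (walks k X)%:R / k`!%:R = \sum_(i < K.+2) layer_term k i X.
Proof.
elim: k X => [|k IH] X kK.
  rewrite big_ord_recl big1 /layer_term /= ?addr0.
    rewrite /layer subn0 big_ord1 /gspread /spread /= fact0; by field.
  by move=> i _.
have E : (walks k.+1 X)%:R / k.+1`!%:R = full_hop (fun Z =>
  \sum_(i < K.+2) layer_term k i Z) X / k.+1%:R.
  rewrite walks_full_hop // /full_hop.
  have h c B : hop c B (fun Z => \sum_(i < K.+2) layer_term k i Z) X =
    hop c B (fun Z => (walks k Z)%:R) X / k`!%:R.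
    by rewrite -hopZ; apply: hop_ext => Z; rewrite IH // ltnW.
  rewrite !h factS natrM; field.
  by rewrite addrC natr1 !pnatr_eq0 -!lt0n !fact_gt0.
rewrite {}E; apply: (canLR (mulfK _)); first by rewrite pnatr_eq0.
have -> : full_hop (fun Z => \sum_(i < K.+2) layer_term k i Z) X =
  \sum_(i < K.+2) full_hop (layer_term k i) X.
  by rewrite /full_hop !hop_sum -!big_split.
have term i : full_hop (layer_term k i) X =
    (if (i.*2 <= k.+1)%N then (k.+1 - i.*2)%:R * layer (k.+1 - i.*2) X / i`!%:R else 0) +
    (if (i.*2.+1 <= k)%N then 2 * layer (k.-1 - i.*2) X / i`!%:R else 0).
  have hz c B : hop c B (fun _ : config N => 0 : R) X = 0 by rewrite /hop big1.
  rewrite /layer_term; case: (leqP i.*2 k) => ik; last first.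
    rewrite /full_hop !hz !addr0 [X in _ = _ + X]ifF ?addr0; last by lia.
    case: leqP => // ik'; have -> : (k.+1 - i.*2 = 0)%N by lia.
    by rewrite !mul0r.
  rewrite [X in _ = X + _]ifT; last by lia.
  have -> : full_hop (fun Z => layer (k - i.*2) Z / i`!%:R) X =
    full_hop (layer (k - i.*2)) X / i`!%:R.
    by rewrite /full_hop !hopZ !mulrDl.
  rewrite full_hop_layer; last by lia.
  rewrite mulrDl subSn //; congr (_ + _).
  case: (ltnP i.*2 k) => ik'; last first.
    have -> : (k - i.*2 = 0)%N by lia.
    by rewrite mul0r.
  by have -> : (k - i.*2 = (k.-1 - i.*2).+1)%N by lia.
under eq_bigr do rewrite term.
rewrite big_split /= [X in _ + X]big_ord_recr /= [X in _ + (_ + X)]ifF ?addr0; last by lia.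
have shift : \sum_(i < K.+1) (if (i.*2 < k)%N then 2 * layer (k.-1 - i.*2) X / i`!%:R
  else 0) =
   \sum_(i < K.+2) (if (i.*2 <= k.+1)%N then (i.*2)%:R * layer (k.+1 - i.*2) X / i`!%:R
     else 0).
  rewrite [RHS]big_ord_recl /= !mul0r add0r; apply: eq_bigr => i _;
    rewrite /bump /= add1n doubleS !ltnS.
  case: ifP => // ik; have -> : (k.+1 - (i.*2).+2 = k.-1 - i.*2)%N by lia.
  have -> : (i.*2.+2)%:R = 2 * i.+1%:R :> R by rewrite -natrM -mul2n; congr (_%:R); lia.
  rewrite factS natrM; field.
  by rewrite addrC natr1 !pnatr_eq0 -!lt0n !fact_gt0.
rewrite shift -big_split mulr_suml; apply: eq_bigr => i _; rewrite /layer_term.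
case: ifP => ik /=; last by rewrite addr0 mul0r.
rewrite -!mulrDl -natrD subnK //; ring.
Qed.

Definition left_depth (p : int) : nat := if p < m then absz (m - p)%R else 0%N.
Definition right_depth (p : int) : nat := if m < p then absz (p - m)%R else 0%N.

(** The numbers [a] and [b] can be read on the configuration, as the total
displacements at the left and at the right of [m]. *)
Lemma spread_depth a b X : spread m K%:Z a b X != 0%N ->
  weight left_depth X = (weight left_depth (step_config N) + a)%N /\
  weight right_depth X = (weight right_depth (step_config N) + b)%N.
Proof.
elim: a X => [|a IH] X.
  elim: b X => [|b IH] X.
    by rewrite /spread /= /origin eqb0 negbK => /eqP ->; rewrite !addn0.
  case/hop_neq0 => j [jB e /IH[h1 h2]]; move: jB; rewrite (mem_right Km mKN K0) => jB.
  have := weight_exchange left_depth e; have := weight_exchange right_depth e.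
  rewrite /= h1 h2 /left_depth /right_depth; do ! case: ifP => ?; lia.
case/hop_neq0 => j [jB e /IH[h1 h2]]; move: jB; rewrite (mem_left Km mKN K0) => jB.
have := weight_exchange left_depth e; have := weight_exchange right_depth e.
rewrite /= h1 h2 /left_depth /right_depth; do ! case: ifP => ?; lia.
Qed.

Lemma gspread_uniq a b a' b' X : gspread a b X != 0 -> gspread a' b' X != 0 ->
  a = a' /\ b = b'.
Proof.
have nz c d : gspread c d X != 0 -> spread m K%:Z c d X != 0%N.
  by apply: contraNN => /eqP E; rewrite /gspread E mul0r.
move=> /nz/spread_depth[h1 h2] /nz/spread_depth[h3 h4]; lia.
Qed.

End Amplitudes.

(** * The exact truncated probability *)

Section ExactTruncation.
Variables (R : realType) (t : R) (N K : nat) (m : int).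
Hypotheses (Km : K%:Z < m) (mKN : m + K%:Z <= N%:Z).
Local Notation normc := ComplexField.Normc.normc.
Local Notation Re := complex.Re.
Local Notation Im := complex.Im.
Local Notation G := (@gspread R N K m).
Implicit Types X : config N.

(** The truncation of the series of [e^{-t^2}] that occurs when the exponential series
of the Hamiltonian is truncated. *)
Definition expN2 (j : nat) : R := \sum_(i < j./2.+1) (- t ^+ 2) ^+ i / i`!%:R.

Lemma phase_shift n i : Re (phase R (n + i.*2)) = (-1) ^+ i * Re (phase R n) /\
  Im (phase R (n + i.*2)) = (-1) ^+ i * Im (phase R n).
Proof.
elim: i => [|i [IH1 IH2]]; first by rewrite addn0 expr0 !mul1r.
rewrite doubleS !addnS; have [-> ->] := phaseS R (n + i.*2).+1.
by have [-> ->] := phaseS R (n + i.*2); rewrite IH1 IH2 exprS !mulNr !mul1r.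
Qed.

Lemma layer_single a0 b0 X n : G a0 b0 X != 0 ->
  layer R K m n X = if n == (a0 + b0)%N then G a0 b0 X else 0.
Proof.
move=> nz; rewrite /layer.
have z a b : (a, b) != (a0, b0) -> G a b X = 0.
  move=> ne; apply/eqP; apply: contraNT ne => nz'.
  by have [-> ->] := gspread_uniq Km mKN nz' nz.
case: eqP => [->|ne]; last first.
  rewrite big1 // => a _; apply: z; apply/eqP => -[ea eb]; apply: ne; rewrite -ea -eb.
  by rewrite subnKC // -ltnS.
have a0lt : (a0 < (a0 + b0).+1)%N by rewrite ltnS leq_addr.
rewrite (bigD1 (Ordinal a0lt)) //= big1 ?addr0; first by rewrite addKn.
move=> a ne; apply: z; apply/eqP => -[ea _].
by case/eqP: ne; apply: val_inj.
Qed.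

(** For each [i] the only index [k] left is [n0 + 2 i]. *)
Lemma collapse (c : nat -> R) (F : nat -> R) n0 : (n0 <= K)%N ->
  \sum_(0 <= k < K.+1) c k * (\sum_(i < K.+2) (if (i.*2 <=
    k)%N then (if (k - i.*2 == n0)%N then F i else 0) else 0)) =
  \sum_(i < (K - n0)./2.+1) c (n0 + i.*2)%N * F i.
Proof.
move=> n0K; rewrite big_mkord.
under eq_bigr do rewrite mulr_sumr.
rewrite exchange_big /=.
have inner (i : 'I_K.+2) : \sum_(k < K.+1) c k * (if (i.*2 <=
  k)%N then (if (k - i.*2 == n0)%N then F i else 0) else 0) =
    if (n0 + i.*2 <= K)%N then c (n0 + i.*2)%N * F i else 0.
  case: leqP => h; last first.
    rewrite big1 // => k _; case: ifP => h1; last by rewrite mulr0.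
    case: eqP => h2; last by rewrite mulr0.
    by exfalso; have := ltn_ord k; lia.
  rewrite (bigD1 (Ordinal (h : (n0 + i.*2 < K.+1)%N))) //= leq_addl addnK eqxx big1
    ?addr0 //.
  move=> k ne; case: ifP => h1; last by rewrite mulr0.
  case: eqP => h2; last by rewrite mulr0.
  by case/eqP: ne; apply: val_inj => /=; lia.
under eq_bigr do rewrite inner.
rewrite -big_mkcond /=.
rewrite -(big_mkord (fun i => (n0 + i.*2 <= K)%N) (fun i => c (n0 + i.*2)%N * F i)).
rewrite (@big_cat_nat _ _ _ (K - n0)./2.+1) //=; last by lia.
rewrite [X in _ + X]big_nat_cond [X in _ + X]big1 ?addr0; last by move=> i; lia.
rewrite big_nat_cond (eq_bigl (fun i => (0 <= i < (K - n0)./2.+1)%N));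
  last by move=> i; lia.
by rewrite -big_nat big_mkord.
Qed.

Lemma part_single a0 b0 X : (a0 + b0 <= K)%N -> G a0 b0 X != 0 ->
  normc (evo_trunc t K.+1 X) ^+ 2 =
  (t ^+ (a0 + b0) * G a0 b0 X * expN2 (K - (a0 + b0))) ^+ 2.
Proof.
move=> ab nz; set n0 := (a0 + b0)%N.
have ampE k : (k <= K)%N -> amp t k X = t ^+ k * \sum_(i < K.+2) (if (i.*2 <=
  k)%N then (if (k - i.*2 == n0)%N then G a0 b0 X / i`!%:R else 0) else 0).
  move=> kK; rewrite /amp -mulrA [_^-1 * _]mulrC (walks_layers R Km mKN) ?(leq_trans kK) //.
  congr (_ * _); apply: eq_bigr => i _; rewrite /layer_term (layer_single _ nz).
  by case: ifP => // _; case: ifP => // _; rewrite mul0r.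
have E (f : R[i] -> R) : (forall i, f (phase R (n0 + i.*2)) = (-1) ^+ i * f (phase R n0)) ->
   \sum_(0 <= k < K.+1) f (phase R k) * amp t k X =
     f (phase R n0) * (t ^+ n0 * G a0 b0 X * expN2 (K - n0)).
  move=> fs; have -> : \sum_(0 <= k < K.+1) f (phase R k) * amp t k X =
     \sum_(0 <= k < K.+1) (f (phase R k) * t ^+ k) * \sum_(i < K.+2) (if (i.*2 <=
       k)%N then (if (k - i.*2 == n0)%N then G a0 b0 X / i`!%:R else 0) else 0).
    by apply: eq_big_nat => k kK; rewrite ampE ?mulrA // -ltnS.
  rewrite (collapse (fun k => f (phase R k) * t ^+ k) (fun i => G a0 b0 X / i`!%:R) ab).
  rewrite /expN2 !mulr_sumr; apply: eq_bigr => i _; rewrite fs.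
  by rewrite exprD -mul2n exprM [(- t ^+ 2) ^+ i]exprNn; ring.
rewrite normc_sqr Re_exp_partial Im_exp_partial.
rewrite (E (@complex.Re R)) ?(E (@complex.Im R));
  first by rewrite !exprMn -mulrDl phase_unit mul1r.
  by move=> i; have [] := phase_shift n0 i.
by move=> i; have [] := phase_shift n0 i.
Qed.

(** At most one pair [(a, b)] contributes at a given configuration, so that there is
no interference. *)
Lemma part_sqr X : normc (evo_trunc t K.+1 X) ^+ 2 =
  \sum_(a < K.+1) \sum_(b < (K - a).+1) (t ^+ (a + b) * G a b X * expN2 (K - (a + b))) ^+ 2.
Proof.
case: (pselect (exists a b, (a + b <= K)%N /\ G a b X != 0)) => [[a0 [b0 [ab nz]]]|none].
  have z a b : (a, b) != (a0, b0) -> G a b X = 0.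
    move=> ne; apply/eqP; apply: contraNT ne => nz'.
    by have [-> ->] := gspread_uniq Km mKN nz' nz.
  rewrite (part_single ab nz).
  have alt : (a0 < K.+1)%N by lia.
  have blt : (b0 < (K - a0).+1)%N by lia.
  rewrite (bigD1 (Ordinal alt)) //= [X in _ = _ + X]big1 ?addr0; last first.
    move=> a ne; apply: big1 => b _; rewrite z ?mulr0 ?mul0r ?expr0n //.
    by apply: contraNN ne => /eqP[ea _]; apply/eqP/val_inj.
  rewrite (bigD1 (Ordinal blt)) //= big1 ?addr0 //.
  move=> b ne; rewrite z ?mulr0 ?mul0r ?expr0n //.
  by apply: contraNN ne => /eqP[ea]; apply/eqP/val_inj.
have z a b : (a + b <= K)%N -> G a b X = 0.
  by move=> ab; apply/eqP/negP => /negP nz; apply: none; exists a, b.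
rewrite [RHS]big1; last first.
  move=> a _; apply: big1 => b _; rewrite z ?mulr0 ?mul0r ?expr0n //.
  by have := ltn_ord a; have := ltn_ord b; lia.
have a0 k : (k <= K)%N -> amp t k X = 0.
  move=> kK; rewrite /amp -mulrA [_^-1 * _]mulrC (walks_layers R Km mKN) ?(leq_trans kK) //.
  rewrite big1 ?mulr0 // => i _; rewrite /layer_term; case: ifP => // ik.
  rewrite /layer big1 ?mul0r // => a _; apply: z.
  by have := ltn_ord a; lia.
rewrite normc_sqr Re_exp_partial Im_exp_partial !big_nat !big1 ?expr0n ?addr0 //.
  by move=> k /andP[_ kK]; rewrite a0 ?mulr0.
by move=> k /andP[_ kK]; rewrite a0 ?mulr0.
Qed.

Lemma le_leftmost X x : (0 < N)%N -> x <= leftmost X <-> (forall p, occ X p -> x <= p).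
Proof.
move=> N0; rewrite /leftmost.
have srt : sorted <=%R (sort <=%R (enum_fset (val X))).
  by apply: sort_sorted; exact: le_total.
have mem p : (p \in sort <=%R (enum_fset (val X))) = occ X p by rewrite mem_sort.
have sz : size (sort <=%R (enum_fset (val X))) = N.
  by rewrite size_sort; exact/eqP/(valP X).
move: srt mem sz; case: (sort _ _) => [|y r] srt mem sz; first by rewrite -sz in N0.
rewrite /=; split => [xy p|]; last by apply; rewrite -mem mem_head.
rewrite -mem inE => /orP[/eqP -> //|pr]; apply: (le_trans xy).
by move: srt => /= /(order_path_min le_trans)/allP/(_ _ pr).
Qed.

Definition lis_count (x : int) (a : nat) : nat := #|[pred s : 'S_a | (lis s)%:Z <= 1 - x]|.

(** The contributions of the pairs [(a, b)] add up, and each is the product of a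
norm at the right end and of a number of permutations at the left end. *)
Lemma prob_part_exact x : x <= 1 ->
  prob_part t K.+1 [set X : config N | x <= leftmost X] =
  (\sum_(a < K.+1) (t ^+ 2) ^+ a * (lis_count x a)%:R / a`!%:R ^+ 2 *
     \sum_(b < (K - a).+1) (t ^+ 2) ^+ b / b`!%:R * expN2 (K - a - b) ^+ 2)%:E.
Proof.
move=> x1; set S := [set X | _]; have K0 : 0 <= K%:Z by [].
have N0 : (0 < N)%N by lia.
have inv j X : m <= j -> S X -> S (exchange j X).
  move=> mj /(le_leftmost X x N0) h; apply/(le_leftmost _ x N0) => p.
  by rewrite occ_exchangeE; case: eqP => [? _|_]; [lia|case: eqP => [? _|_ /h]; lia].
transitivity (\esum_(X in S) \sum_(a < K.+1) \sum_(b < (K - a).+1)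
   ((t ^+ (a + b) * expN2 (K - (a + b)) / (a`! * b`!)%:R) ^+ 2)%:E *
     ((spread m K%:Z a b X * spread m K%:Z a b X)%N%:R)%:E)%E.
  apply: eq_esum => X _; rewrite part_sqr -sumEFin; apply: eq_bigr => a _.
  rewrite -sumEFin; apply: eq_bigr => b _; rewrite -EFinM /gspread natrM; congr (_%:E).
  by rewrite !exprMn; ring.
rewrite esum_sum; last by move=> X a _ _; apply: sume_ge0 => b _;
  rewrite -EFinM lee_fin mulr_ge0 ?sqr_ge0.
rewrite -sumEFin; apply: eq_bigr => a _.
rewrite esum_sum; last by move=> X b _ _; rewrite -EFinM lee_fin mulr_ge0 ?sqr_ge0.
rewrite mulr_sumr -sumEFin; apply: eq_bigr => b _.
rewrite esumZl ?sqr_ge0 //.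
have aK : a%:Z <= K%:Z by have := ltn_ord a; lia.
have bK : b%:Z <= K%:Z by have := ltn_ord b; lia.
rewrite -/(overlap R S (spread m K a b) (spread m K a b)).
rewrite (@spread_norm_right R N m K%:Z Km mKN K0 S a b aK bK inv) (left_norm R Km mKN
  K0 x aK).
rewrite -!EFinM; congr (_%:E); rewrite -/(lis_count x a) subnDA natrM.
rewrite exprD [t ^+ 2 ^+ a]exprAC [t ^+ 2 ^+ b]exprAC.
have a0 : a`!%:R != 0 :> R by rewrite pnatr_eq0 -lt0n fact_gt0.
have b0 : b`!%:R != 0 :> R by rewrite pnatr_eq0 -lt0n fact_gt0.
by field; rewrite a0 b0.
Qed.

End ExactTruncation.

(** * The limit of many particles *)

Section Limits.
Variable R : realType.

(** Dominated convergence for the convolution of a summable sequence and a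
convergent one. *)
Lemma convolution_cvg (p u : R^nat) (M B l : R) :
  (forall a, 0 <= p a) -> (forall n, \sum_(0 <= a < n) p a <= M) ->
  (forall j, `|u j| <= B) -> u @ \oo --> l ->
  (fun K => \sum_(a < K.+1) p a * u (K - a)%N) @ \oo --> limn (series p) * l.
Proof.
move=> p0 pM uB ul.
have cp : cvgn (series p).
  apply: nondecreasing_is_cvgn; first by apply: (@nondecreasing_series _ p xpredT).
  by exists M => _ [n _ <-]; exact: pM.
have M0 : 0 <= M by have := pM 0%N; rewrite big_geq.
have B0 : 0 <= B by apply: le_trans (uB 0%N).
have lB : `|l| <= B.
  have -> : l = limn u by apply/esym/cvg_lim.
  have cu : cvgn u by apply/cvg_ex; exists l.
  rewrite ler_norml; apply/andP; split.
    by apply: limr_ge => //; apply: nearW => n; have := uB n; rewrite ler_norml => /andP[].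
  by apply: limr_le => //; apply: nearW => n; have := uB n; rewrite ler_norml => /andP[].
have -> : (fun K => \sum_(a < K.+1) p a * u (K - a)%N) =
   (fun K => series p K.+1 * l + \sum_(a < K.+1) p a * (u (K - a)%N - l)).
  apply/funext => K; rewrite /series /= big_mkord mulr_suml -big_split /=.
  by apply: eq_bigr => a _; ring.
rewrite -[X in _ --> X]addr0; apply: cvgD.
  by apply: cvgMr_tmp; rewrite (cvg_shiftS (series p)).
apply/cvgr0Pnorm_lt => e e0.
pose d := e / (M + 2 * B + 1).
have d0 : 0 < d by rewrite divr_gt0 //; lra.
have f1 : \forall j \near \oo, `|u j - l| < d by apply: cvgr_distC_lt.
have f2 := near_small (tail_cvg p0 pM) d0.
have [n1 _ h1] := f1; have [n2 _ h2] := f2.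
exists (n1 + n2)%N => // K /= nK.
apply: le_lt_trans (ler_norm_sum _ _ _) _.
rewrite -(big_mkord xpredT (fun a => `|p a * (u (K - a)%N - l)|)).
rewrite (@big_cat_nat _ _ _ n2) //=; last by lia.
have s1 : \sum_(0 <= a < n2) `|p a * (u (K - a)%N - l)| <= d * M.
  apply: (@le_trans _ _ (\sum_(0 <= a < n2) d * p a)); last first.
    by rewrite -mulr_sumr ler_wpM2l // ltW.
  rewrite !big_nat; apply: ler_sum => a /andP[_ an].
  rewrite normrM (ger0_norm (p0 a)) mulrC ler_wpM2r // ltW //; apply: h1 => /=; lia.
have s2 : \sum_(n2 <= a < K.+1) `|p a * (u (K - a)%N - l)| <= d * (2 * B).
  apply: (@le_trans _ _ (\sum_(n2 <= a < K.+1) p a * (2 * B))).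
    apply: ler_sum => a _; rewrite normrM (ger0_norm (p0 a)) ler_wpM2l //.
    apply: le_trans (ler_normB _ _) _; rewrite mulr_natl mulr2n; exact: lerD.
  rewrite -mulr_suml ler_wpM2r ?mulr_ge0 // ltW // -lte_fin.
  by apply: le_lt_trans (partial_tail _ _ p0) _; apply: (h2 n2) => /=.
apply: le_lt_trans (lerD s1 s2) _.
have -> : e = d * (M + 2 * B + 1) by rewrite /d divfK //; apply: lt0r_neq0; lra.
by rewrite -mulrDr ltr_pM2l //; lra.
Qed.

Lemma exp_sum_le (y : R) n : 0 <= y -> \sum_(0 <= k < n) y ^+ k / k`!%:R <= expR y.
Proof.
move=> y0; apply: (@nondecreasing_cvgn_le _ (series (exp_coeff y))).
  by apply: (@nondecreasing_series _ _ xpredT) => k _ _; exact: exp_coeff_ge0.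
exact: is_cvg_series_exp_coeff.
Qed.

Variables (t : R) (x : int).
Hypothesis t0 : 0 < t.

Lemma expN2_le j : `|expN2 t j| <= expR (t ^+ 2).
Proof.
rewrite /expN2; apply: le_trans (ler_norm_sum _ _ _) _.
apply: le_trans (exp_sum_le j./2.+1 (sqr_ge0 t)); rewrite big_mkord.
apply: ler_sum => i _; rewrite normrM normrX normrN (ger0_norm (sqr_ge0 t)).
by rewrite ger0_norm ?invr_ge0.
Qed.

Lemma half_cvg : (fun j => j./2.+1) @ \oo --> \oo.
Proof. by apply/cvgnyPge => A; exists A.*2 => // n /= h; lia. Qed.

Lemma expN2_cvg : expN2 t @ \oo --> expR (- t ^+ 2).
Proof.
have -> : expN2 t = series (exp_coeff (- t ^+ 2)) \o (fun j => j./2.+1).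
  by apply/funext => j; rewrite /expN2 /series /= big_mkord.
apply: cvg_comp half_cvg _; exact: is_cvg_series_exp_coeff.
Qed.

(** The weight of size [a] in the Poissonized law, up to the factor [e^{-t^2}]. *)
Definition plancherel (a : nat) : R :=
  (t ^+ 2) ^+ a * (lis_count x a)%:R / a`!%:R ^+ 2.

Lemma plancherel_ge0 a : 0 <= plancherel a.
Proof. by rewrite /plancherel divr_ge0 ?exprn_ge0 // mulr_ge0 // exprn_ge0 // sqr_ge0. Qed.

Lemma plancherel_le a : plancherel a <= (t ^+ 2) ^+ a / a`!%:R.
Proof.
have f0 : 0 < a`!%:R :> R by rewrite ltr0n fact_gt0.
rewrite /plancherel expr2 invfM mulrA ler_wpM2r ?invr_ge0 ?(ltW f0) //.
rewrite ler_pdivrMr // ler_wpM2l ?exprn_ge0 ?sqr_ge0 // ler_nat -card_Sn.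
exact: max_card.
Qed.

Lemma plancherel_sum n : \sum_(0 <= a < n) plancherel a <= expR (t ^+ 2).
Proof.
apply: le_trans (exp_sum_le n (sqr_ge0 t)); apply: ler_sum => a _.
exact: plancherel_le.
Qed.

Definition truncated (K : nat) : R :=
  \sum_(a < K.+1) plancherel a *
     \sum_(b < (K - a).+1) (t ^+ 2) ^+ b / b`!%:R * expN2 t (K - a - b) ^+ 2.

(** The right end gives [e^{t^2}] times the square of [e^{-t^2}]. *)
Lemma truncated_cvg :
  truncated @ \oo --> limn (series plancherel) * expR (- t ^+ 2).
Proof.
pose S j := \sum_(b < j.+1) (t ^+ 2) ^+ b / b`!%:R * expN2 t (j - b) ^+ 2.
have q0 b : 0 <= (t ^+ 2) ^+ b / b`!%:R by rewrite divr_ge0 // exprn_ge0 // sqr_ge0.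
have e2 j : `|expN2 t j ^+ 2| <= expR (t ^+ 2) ^+ 2.
  by rewrite normrX ler_pXn2r ?nnegrE ?expR_ge0 //; exact: expN2_le.
have cS : S @ \oo --> expR (- t ^+ 2).
  have -> : expR (- t ^+ 2) = limn (series (exp_coeff (t ^+ 2))) * expR (- t ^+ 2) ^+ 2.
    by rewrite -/(expR (t ^+ 2)) expr2 mulrA expRxMexpNx_1 mul1r.
  apply: (@convolution_cvg (exp_coeff (t ^+ 2)) (fun j =>
    expN2 t j ^+ 2) (expR (t ^+ 2)) _ _ q0 _ e2).
    by move=> n; apply: exp_sum_le; exact: sqr_ge0.
  by rewrite !expr2; apply: cvgM; exact: expN2_cvg.
have bS j : `|S j| <= expR (t ^+ 2) * expR (t ^+ 2) ^+ 2.
  apply: le_trans (ler_norm_sum _ _ _) _.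
  apply: (@le_trans _ _ (\sum_(b < j.+1) (t ^+ 2) ^+ b / b`!%:R * expR (t ^+ 2) ^+ 2)).
    by apply: ler_sum => b _; rewrite normrM (ger0_norm (q0 _)) ler_wpM2l.
  rewrite -mulr_suml ler_wpM2r ?sqr_ge0 //.
  by rewrite -(big_mkord xpredT (fun b => (t ^+ 2) ^+ b / b`!%:R));
    apply: exp_sum_le; exact: sqr_ge0.
exact: (convolution_cvg plancherel_ge0 plancherel_sum bS cS).
Qed.

Lemma poisson_lis (d : measure_display) (T : measurableType d)
    (P : probability T R) (sigma : T -> {n : nat & 'S_n}) :
  poissonized_uniform_perm P (t ^+ 2) sigma ->
  P [set w | (lis (tagged (sigma w)))%:Z <= 1 - x] =
  (limn (series plancherel) * expR (- t ^+ 2))%:E.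
Proof.
move=> [meas pois unif].
pose F (n : nat) (s : 'S_n) : set T := [set w | sigma w = Tagged (fun n => 'S_n) s].
pose good n := [pred s : 'S_n | (lis s)%:Z <= 1 - x].
pose E n : set T := \bigcup_(s in [set` enum (good n)]) F n s.
have mE n : measurable (E n).
  by apply: fin_bigcup_measurable => // s _; exact: meas.
have -> : [set w | (lis (tagged (sigma w)))%:Z <= 1 - x] = \bigcup_n E n.
  apply/seteqP; split => [w /= h|w [n _ [s /= sg Fs]]].
    exists (tag (sigma w)) => //; exists (tagged (sigma w)); first by rewrite /= mem_enum.
    by rewrite /F /=; case: (sigma w).
  by move: sg; rewrite mem_enum /= inE Fs.
rewrite measure_bigcup //; last first.
  apply/trivIsetP => i j _ _ ij; apply/seteqP; split => // w [[s _ Fs] [s' _ Fs']].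
  by move/eqP: ij; apply; have := congr1 tag (etrans (esym Fs) Fs').
have PE n : P (E n) = (plancherel n * expR (- t ^+ 2))%:E.
  rewrite measure_fin_bigcup //; last 2 first.
  - move=> s s' _ _ [w [Fs Fs']].
    by have := etrans (esym Fs) Fs'; exact: eq_from_Tagged.
  - by move=> s _; exact: meas.
  rewrite -fsbig_seq ?enum_uniq //.
  rewrite (eq_bigr (fun=> (poisson_pmf (t ^+ 2) n * n`!%:R^-1)%:E)); last first.
    by move=> s _; rewrite EFinM -pois; exact: unif.
  rewrite sumEFin big_const_seq count_predT -cardE iter_addr_0.
  rewrite /poisson_pmf exprn_gt0 // /plancherel -/(lis_count x n) -mulr_natr; congr (_%:E).
  have f0 : n`!%:R != 0 :> R by rewrite pnatr_eq0 -lt0n fact_gt0.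
  by field.
rewrite (eq_eseriesr (fun n _ => PE n)).
apply/cvg_lim => //.
have -> : (fun n => (\sum_(0 <= k < n | k \in [set: nat]) (plancherel k * expR (- t ^+
  2))%:E)%E) =
   EFin \o (fun n => series plancherel n * expR (- t ^+ 2)).
  apply/funext => n; rewrite /= /series /= mulr_suml -sumEFin.
  by apply: eq_bigl => k; rewrite in_setT.
apply: cvg_EFin; first exact: nearW.
apply: cvgMr_tmp; apply: nondecreasing_is_cvgn.
  by apply: (@nondecreasing_series _ plancherel xpredT) => k _ _; exact: plancherel_ge0.
by exists (expR (t ^+ 2)) => _ [n _ <-]; exact: plancherel_sum.
Qed.

End Limits.

Theorem theorem3 (R : realType) (t : R) (x : int)
  (d : measure_display) (T : measurableType d) (P : probability T R)
  (sigma : T -> {n : nat & 'S_n}) :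
  0 < t -> x <= 1 ->
  poissonized_uniform_perm P (t ^+ 2) sigma ->
  prob_leftmost_ge 0 t (step_config N) x @[N --> \oo]
    --> P [set w | (lis (tagged (sigma w)))%:Z <= 1 - x].
Proof.
move=> t0 x1 hsigma; rewrite (poisson_lis x t0 hsigma).
have [s [M [s0 sM]]] := major_summable t0.
(* the largest number of moves for which a full site [K N + 1] separates the ends *)
pose K N := N.-1./2.
have Koo : K @ \oo --> \oo by apply/cvgnyPge => A; exists (A.*2.+1) => // n /= h;
  rewrite /K; lia.
pose err N := ((4 * M)%:E * tail (major t s) (K N).+1)%E.
have M0 := M_ge0 sM.
have errfin N : err N \is a fin_num.
  by rewrite fin_numM // (tail_fin _ _ sM) // => k; exact: major_ge0.
have err0 : err @ \oo --> 0%E.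
  rewrite -[X in _ --> X](mule0 (4 * M)%:E); apply: cvgeZl => //.
  have := major_tail_cvg t0 sM => /(cvg_comp (fun N => (K N).+1) _) h; apply: h.
  by apply/cvgnyPge => A; exists (A.*2.+1) => // n /= h; rewrite /K; lia.
have tcvg : ((truncated t x (K N))%:E @[N --> \oo] --> (limn (series (plancherel t x))
  * expR (- t ^+ 2))%:E)%E.
  apply: cvg_EFin; first exact: nearW.
  apply: (@cvg_comp _ _ _ K (truncated t x)); [exact: Koo|exact: truncated_cvg].
apply: (@squeeze_cvge _ _ _ _ (fun N =>
  (truncated t x (K N))%:E - err N)%E _ (fun N => (truncated t x (K N))%:E + err N)%E).
- exists 1%N => // N /= N1.
  have [h1 h2] := @prob_truncate R t s M t0 s0 sM N (K N).+1 [set X | x <= leftmost X].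
  have kn : (K N)%:Z < (K N).+1%:Z by rewrite ltz_nat.
  have mk : (K N).+1%:Z + (K N)%:Z <= N%:Z by rewrite /K; lia.
  rewrite (prob_part_exact t kn mk x1) in h1 h2.
  apply/andP; split; last exact: h1.
  by rewrite leeBlDr.
- by rewrite -[X in _ --> X]sube0; apply: cvgeB => //; rewrite fin_num_adde_defl.
- by rewrite -[X in _ --> X]adde0; apply: cvgeD.
Qed.
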